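(* Let $m\geq1$ and $k\geq1$ be fixed integers and let $A_{m}=\{1,\sqrt{2},\sqrt{3},\dots,\sqrt{m}\}$. Then \[ \chi_{k}(\mathbb{R}^{n},A_{m})\geq\left(\Gamma_{\chi}\sqrt{\frac{m+1}{k}}+o(1)\right)^{n}, \] where $o(1)$ denotes a quantity tending to $0$ as $n\to\infty$, and $\Gamma_{\chi}=\sqrt{\frac{\pi}{2}}\max_{x>0}\frac{1-e^{-x}}{\sqrt{x}}$.
   Context: For a finite set $A\subset\mathbb{R}_{>0}$, $G_{A}(\mathbb{R}^{n})$ is the graph with vertex set $\mathbb{R}^{n}$ in which $x,y$ are adjacent iff $\|x-y\|_{2}\in A$. For a graph $G$, $\chi_{k}(G)$ is the minimum number of colors needed to color the vertices of $G$ so that no color class contains a $(k+1)$-clique. $\chi_{k}(\mathbb{R}^{n},A)=\chi_{k}(G_{A}(\mathbb{R}^{n}))$. *)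

(* Defs.v *)
From HB Require Import structures.
From mathcomp Require Import all_boot all_order all_algebra.
From mathcomp Require Import all_classical all_reals all_analysis.

Set Implicit Arguments.
Unset Strict Implicit.
Unset Printing Implicit Defensive.

Import Order.TTheory GRing.Theory Num.Theory.
Import numFieldNormedType.Exports.

Local Open Scope classical_set_scope.
Local Open Scope ring_scope.

(* A graph on a vertex type V is given by its adjacency relation. *)

Definition is_clique (V : Type) (adj : V -> V -> Prop) (r : nat) (S : set V) :
    Prop :=
  (S #= `I_r)%card /\ forall x y, S x -> S y -> x <> y -> adj x y.

Definition clique_free_coloring (V : Type) (adj : V -> V -> Prop) (k c : nat)
    (f : V -> 'I_c) : Prop :=
  forall i : 'I_c,
    ~ exists2 S : set V, is_clique adj k.+1 S & S `<=` f @^-1` [set i].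

Definition clique_free_colorable (V : Type) (adj : V -> V -> Prop)
    (k c : nat) : Prop :=
  exists f : V -> 'I_c, clique_free_coloring adj k f.

(* The value is +oo when no finite number of colors suffices; otherwise the
   infimum is a minimum, see chi_attained. *)
Definition chi (R : realType) (V : Type) (adj : V -> V -> Prop) (k : nat) :
    \bar R :=
  ereal_inf [set (c%:R)%:E | c in [set c | clique_free_colorable adj k c]].

Lemma chi_attained (R : realType) (V : Type) (adj : V -> V -> Prop)
    (k c0 : nat) :
  clique_free_colorable adj k c0 ->
  exists c, [/\ clique_free_colorable adj k c,
    forall c', clique_free_colorable adj k c' -> (c <= c')%N
    & chi R adj k = (c%:R)%:E].
Proof.
move=> col0.
have ex : exists c, `[< clique_free_colorable adj k c >].
  by exists c0; apply/asboolP.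
case: (ex_minnP ex) => c /asboolP colc minc.
have cmin c' : clique_free_colorable adj k c' -> (c <= c')%N.
  by move=> colc'; apply: minc; apply/asboolP.
exists c; split=> //; apply/eqP; rewrite eq_le; apply/andP; split.
  by apply: ereal_inf_lbound; exists c.
by apply: le_ereal_inf_tmp => _ [c' colc' <-]; rewrite lee_fin ler_nat cmin.
Qed.

(* The norm that the library puts on 'rV[R]_n is the sup norm. *)
Definition norm2 (R : realType) (n : nat) (x : 'rV[R]_n) : R :=
  Num.sqrt (\sum_(i < n) x ord0 i ^+ 2).

(* Irreflexive, hence a simple graph, when A contains only positive reals. *)
Definition distance_graph (R : realType) (n : nat) (A : set R) :
    'rV[R]_n -> 'rV[R]_n -> Prop :=
  fun x y => A (norm2 (x - y)).

Definition chi_dist (R : realType) (k n : nat) (A : set R) : \bar R :=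
  chi R (@distance_graph R n A) k.

Definition sqrt_distances (R : realType) (m : nat) : set R :=
  [set Num.sqrt (j%:R : R) | j in [set j : nat | (1 <= j <= m)%N]].
Arguments sqrt_distances : clear implicits.

Definition gamma_ratio (R : realType) (x : R) : R :=
  (1 - expR (- x)) / Num.sqrt x.

(* The supremum is a maximum, see gamma_ratio_max. *)
Definition Gamma_chi (R : realType) : R :=
  Num.sqrt (pi / 2) * sup [set gamma_ratio x | x in [set x : R | 0 < x]].

Lemma gamma_ratio_max (R : realType) :
  exists x : R, [/\ 0 < x, forall y, 0 < y -> gamma_ratio y <= gamma_ratio x
    & sup [set gamma_ratio x | x in [set x : R | 0 < x]] = gamma_ratio x].
Proof.
suff [x x0 xmax] : exists2 x : R, 0 < x &
    forall y, 0 < y -> gamma_ratio y <= gamma_ratio x.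
  exists x; split=> //; apply/eqP; rewrite eq_le; apply/andP; split.
    apply: ge_sup; first by exists (gamma_ratio x), x.
    by move=> _ [y /= y0 <-]; exact: xmax.
  apply: ub_le_sup; last by exists x.
  by exists (gamma_ratio x) => _ [y /= y0 <-]; exact: xmax.
have cont : {within `[4^-1, 4 : R], continuous (@gamma_ratio R)}.
  apply: continuous_in_subspaceT => x; rewrite inE /= in_itv /= => /andP[x4 _].
  have x0 : 0 < x by rewrite (lt_le_trans _ x4)// invr_gt0.
  apply: cvgM.
    apply: cvgB; first exact: cvg_cst.
    apply: continuous_comp; first exact: opp_continuous.
    exact: continuous_expR.
  apply: cvgV; first by rewrite gt_eqF// sqrtr_gt0.
  exact: sqrt_continuous.
have le44 : 4^-1 <= 4 :> R.
  by rewrite (@le_trans _ _ 1)// ?invf_le1// ler1n.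
have [x + xmax] := EVT_max le44 cont.
rewrite in_itv /= => /andP[x4 _].
have x0 : 0 < x by rewrite (lt_le_trans _ x4)// invr_gt0.
exists x => // y y0.
have s4 : Num.sqrt (4 : R) = 2.
  by rewrite (_ : 4 = 2 ^+ 2) ?sqrtr_sqr ?ger0_norm// -natrX.
have half : 2^-1 <= gamma_ratio x.
  have /xmax : (1 : R) \in `[4^-1, 4].
    by rewrite in_itv /= invf_le1// ler1n.
  apply: le_trans; rewrite /gamma_ratio sqrtr1 divr1 expRN.
  rewrite lerBrDr -lerBrDl (_ : 1 - 2^-1 = 2^-1 :> R); last first.
    by rewrite {1}(splitr 1) div1r addrK.
  by rewrite lef_pV2 ?posrE ?expR_gt0// (le_trans _ (expR_ge1Dx 1)).
have sy0 : 0 < Num.sqrt y by rewrite sqrtr_gt0.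
have [y4|y4] := ltP y 4^-1.
  apply: le_trans half; rewrite /gamma_ratio ler_pdivrMr//.
  apply: (@le_trans _ _ y).
    by rewrite lerBlDr -lerBlDl; apply: le_trans (expR_ge1Dx (- y)).
  rewrite -{1}(sqr_sqrtr (ltW y0)) expr2 ler_pM2r//.
  rewrite -s4 -sqrtrV// ler_sqrt ?invr_gt0//; exact: ltW.
have [y5|y5] := leP y 4; first by apply: xmax; rewrite in_itv /= y4.
apply: le_trans half; rewrite /gamma_ratio ler_pdivrMr//.
apply: (@le_trans _ _ 1); first by rewrite gerBl expR_ge0.
by rewrite mulrC ler_pdivlMr// mul1r -s4 ler_sqrt// ltW.
Qed.

(* Main.v *)
Require Import Defs.
From HB Require Import structures.
From mathcomp Require Import all_boot all_order all_algebra.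
From mathcomp Require Import all_classical all_reals all_analysis.
From mathcomp Require Import ring lra zify.
Import Order.TTheory GRing.Theory Num.Theory.
Import numFieldNormedType.Exports.
Local Open Scope ring_scope.
Set Implicit Arguments.
Unset Strict Implicit.
Unset Printing Implicit Defensive.

(* Let p be a prime and X a finite set of points of Z^n with |x|^2 = s mod 2p and
   |x - y|^2 < 2p(m+1).  For distinct x, y in X, the number |x - y|^2 / (2p)
   belongs to {1, ..., m} iff s - <x, y> = 0 mod p.  If the part S of X in a color
   class of X / sqrt(2p) contains no (k+1)-clique, then for every maximal clique C
   of S the polynomial in y given by the product over x in C of
   (s - <x, y>)^(p-1) - 1 has degree at most k(p-1) and is nonzero on S exactly at
   the points of C; since the maximal cliques cover S, #|S| <= k 'C(n + k(p-1), n).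

   Such an X is cut out of a translate of Z^n by a ball of radius slightly less
   than sqrt(p(m+1)/2) that contains, up to a factor (1 + o(1))^n, as many lattice
   points as its volume.  With p = (1 + o(1)) n / (2kx) this yields the base
   sqrt(pi (m+1) / (2k)) (1 - e^-x) / sqrt(x).

   Such a prime exists for all large n because the ratio of consecutive primes
   tends to 1, which follows from Selberg's symmetry formula by an argument of
   Erdos. *)

(** * Cliques and polynomials over a finite field *)

(** The modulus is 2p and not p because |x - y|^2 is congruent to 2(s - <x, y>) mod 2p: the degree p
    - 1 per factor is unchanged while the admissible squared diameter doubles. The base is a
    quotient. A ball of squared radius p(m+1)/2, about n(m+1)/(4kx), has volume (2 pi e
    (m+1)/(4kx))^(n/2) up to (1 + o(1))^n. With d = k(p-1) close to n/(2x), the binomial theorem at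
    z = e^-x bounds the binomial coefficient by e^(x d) (1 - e^-x)^-n, and e^(x d), close to
    e^(n/2), cancels the power of e in the volume. At the maximizer x of (1 - e^-x)/sqrt(x) one has
    e^-x = 1/(1 + 2x), which is the limit of d/(d + n), so this bound is exponentially sharp.
    Bertrand's postulate would not do: a constant-factor excess of p over n/(2kx) multiplies d and
    spoils the base. *)

(** Expanding the products factors the matrix as coefficients [A] times monomials [B]. The monomials
    of degree [#|D|] in n+1 variables are encoded as sorted tuples of indices. *)
Lemma rank_prod_linear (F : fieldType) (D : finType) (m q n : nat)
    (a : 'I_m -> D -> 'I_n.+1 -> F) (v : 'I_q -> 'I_n.+1 -> F) :
  (\rank (\matrix_(j < m, u < q) \prod_(s : D) \sum_i a j s i * v u i)%R
    <= 'C(#|D| + n, #|D|))%N.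
Proof.
rewrite -card_sorted_tuples; set S := [set t : #|D|.-tuple 'I_n.+1 | _].
pose le (i j : 'I_n.+1) := (i <= j)%N.
pose st (g : {ffun D -> 'I_n.+1}) := sort le [seq g s | s : D].
have stP g : size (st g) == #|D| by rewrite size_sort size_map -cardE.
have stS g : Tuple (stP g) \in S.
  rewrite inE /= sorted_map; apply: sort_sorted => i j; exact: leq_total.
pose A := \matrix_(j < m, t < #|S|)
  \sum_(g : {ffun D -> 'I_n.+1} | Tuple (stP g) == enum_val t) \prod_s a j s (g s).
pose B := \matrix_(t < #|S|, u < q) \prod_(i <- enum_val t) v u i.
suff -> : \matrix_(j < m, u < q) \prod_(s : D) \sum_i a j s i * v u i = A *m B.
  exact: mulmx_max_rank.
apply/matrixP => j u; rewrite !mxE bigA_distr_bigA /=.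
rewrite (partition_big (fun g => enum_rank_in (stS [ffun=> ord0]) (Tuple (stP g))) xpredT) //=.
apply: eq_bigr => t _; rewrite !mxE mulr_suml; apply: eq_big => g.
  apply/eqP/eqP => [<-|->]; first by rewrite enum_rankK_in.
  by rewrite enum_valK_in.
move=> /eqP <-; rewrite enum_rankK_in // big_split /=; congr (_ * _).
transitivity (\prod_(i <- [seq g s | s : D]) v u i); first by rewrite big_map enumT.
by apply: perm_big; rewrite /= /st perm_sym perm_sort.
Qed.

(** A basis of the row space chosen among the rows cannot vanish on a whole column unless every row
    does, so the supports of these [\rank M] rows already cover all columns. *)
Lemma rank_cover (F : fieldType) (m q k : nat) (M : 'M[F]_(m, q)) :
  (forall j, #|[set u | M j u != 0%R]| <= k)%N ->
  (forall u, exists j, M j u != 0) -> (q <= k * \rank M)%N.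
Proof.
move=> Hk Hc; pose f := maxrankfun M.
have cover u : exists i, M (f i) u != 0.
  have [j Mju] := Hc u; apply/existsP; apply: contraNT Mju => /existsPn H.
  have /submxP[X /rowP XE] : (row j M <= rowsub f M)%MS.
    by rewrite (eq_maxrowsub M) row_sub.
  have := XE u; rewrite !mxE => ->; rewrite big1 // => i _.
  by rewrite !mxE; move: (H i); rewrite negbK => /eqP ->; rewrite mulr0.
have : [set: 'I_q] \subset \bigcup_(i < \rank M) [set u | M (f i) u != 0].
  apply/fintype.subsetP => u _; have [i Mi] := cover u.
  by apply/bigcupP; exists i => //; rewrite inE.
move=> /subset_leq_card; rewrite cardsT card_ord => /leq_trans; apply.
apply: leq_trans (_ : \sum_(i < \rank M) k <= _)%N.
  elim/big_rec2: _ => [|i s A _ sA]; first by rewrite cards0.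
  by apply: leq_trans (leq_card_setU _ _) _; rewrite leq_add.
by rewrite sum_nat_const card_ord mulnC.
Qed.

(* A maximal clique C of S is the nonvanishing locus in S of the product, over t
   in C and c <> 0, of the affine forms [sum_i a t i * v u i - c]. *)
Lemma clique_free_bound (F : finFieldType) (T : finType) (n k : nat)
    (adj : rel T) (S : {set T}) (a v : T -> 'I_n.+1 -> F) :
  symmetric adj -> (forall u, v u ord0 = 1) ->
  (forall t u, (\sum_i a t i * v u i == 0) = (t == u) || adj t u) ->
  (forall A : {set T}, A \subset S ->
    {in A &, forall x y, x != y -> adj x y} -> #|A| <= k)%N ->
  (#|S| <= k * 'C(k * #|F|.-1 + n, k * #|F|.-1))%N.
Proof.
move=> adjC v0 lin cf.
pose P (A : {set T}) := (A \subset S) && [forall x in A, forall y in A, (x == y) || adj x y].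
have PP A : P A -> (#|A| <= k)%N.
  move=> /andP[AS /forall_inP cA]; apply: cf => // x y xA yA /negbTE xy.
  by have /forall_inP H := cA x xA; have := H y yA; rewrite xy.
have maxC u : u \in S -> {C : {set T} | maxset P C & u \in C}.
  move=> uS; have P1 : P [set u].
    rewrite /P finset.sub1set uS; apply/forall_inP => x /set1P ->.
    by apply/forall_inP => y /set1P ->; rewrite eqxx.
  by have [C mC uC] := maxset_exists P1; exists C => //; rewrite -finset.sub1set.
pose C (u : 'I_#|S|) : {set T} := s2val (maxC _ (enum_valP u)).
have Cmax u : maxset P (C u) by exact: (s2valP (maxC _ (enum_valP u))).
have Cu u : enum_val u \in C u by exact: (s2valP' (maxC _ (enum_valP u))).
have CP u : P (C u) by have /maxsetP[] := Cmax u.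
(* Cliques with fewer than k points are padded with [enum_val u], itself in [C u]: a factor is
   repeated and the nonvanishing locus is unchanged, while all rows share the index type [D]. *)
pose c (u : 'I_#|S|) (s : 'I_k) : T := nth (enum_val u) (enum (C u)) s.
have cC u s : c u s \in C u.
  rewrite /c; have [h|h] := ltnP s (size (enum (C u))).
    by rewrite -mem_enum mem_nth.
  by rewrite nth_default.
have Cc u t : t \in C u -> exists s, t = c u s.
  rewrite -mem_enum => tC; have h : (index t (enum (C u)) < k)%N.
    by apply: leq_trans (PP _ (CP u)); rewrite cardE index_mem.
  by exists (Ordinal h); rewrite /c /= nth_index.
pose D := ('I_k * {x : F | x != 0})%type.
pose a' (u : 'I_#|S|) (s : D) (i : 'I_n.+1) :=
  a (c u s.1) i - (if i == ord0 then val s.2 else 0).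
pose M := \matrix_(j < #|S|, u < #|S|) \prod_(s : D) \sum_i a' j s i * v (enum_val u) i.
have ME j u : (M j u != 0) = [forall t in C j, (t == enum_val u) || adj t (enum_val u)].
  rewrite mxE.
  have lE s : \sum_i a' j s i * v (enum_val u) i =
      \sum_i a (c j s.1) i * v (enum_val u) i - val s.2.
    under eq_bigr do rewrite mulrBl.
    rewrite sumrB; congr (_ - _).
    rewrite (bigD1 ord0) //= v0 mulr1 big1 ?addr0 // => i /negbTE ->.
    by rewrite mul0r.
  apply/prodf_neq0/forall_inP => [H t /Cc[s ->]|H s _].
    rewrite -lin; apply: contraT => nz.
    by have := H (s, exist (fun x : F => x != 0) _ nz) isT; rewrite lE /= subrr eqxx.
  have := H _ (cC j s.1); rewrite -lin lE => /eqP ->.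
  by rewrite sub0r oppr_eq0 (valP s.2).
(* This is where maximality enters: a point of S equal or adjacent to every point of [C j] could be
   added to it. *)
have supp j : [set u | M j u != 0] \subset [set u | enum_val u \in C j].
  apply/fintype.subsetP => u; rewrite !inE ME => /forall_inP H.
  have /maxsetP[/andP[CS /forall_inP Cj] Cm] := Cmax j.
  have Pu : P (enum_val u |: C j).
    rewrite /P finset.subUset finset.sub1set enum_valP CS /=.
    apply/forall_inP => x /setU1P[->|xC]; apply/forall_inP => y /setU1P[->|yC].
    - by rewrite eqxx.
    - by rewrite eq_sym adjC H.
    - exact: H.
    - by have /forall_inP H' := Cj x xC; apply: H'.
  by rewrite -(Cm _ Pu) ?finset.subsetUr // setU11.
have rk : (\rank M <= 'C(k * #|F|.-1 + n, k * #|F|.-1))%N.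
  have := rank_prod_linear a' (fun u => v (enum_val u)).
  by rewrite card_prod card_ord card_sig -(cardC1 (0 : F)).
apply: leq_trans (leq_mul (leqnn k) rk); apply: rank_cover => [j|u].
  apply: leq_trans (PP _ (CP j)); apply: leq_trans (subset_leq_card (supp j)) _.
  rewrite -(card_imset _ (@enum_val_inj _ (mem S))); apply: subset_leq_card.
  by apply/fintype.subsetP => _ /imsetP[u + ->]; rewrite inE.
exists u; rewrite ME; have /andP[_ /forall_inP H] := CP u.
by apply/forall_inP => t tC; have /forall_inP H' := H t tC; apply: H'.
Qed.

Lemma distance_coloring_bound (R : realType) (m k n p c : nat) (T : finType)
    (x : T -> 'I_n -> int) (s : int) :
  prime p -> (forall t u, x t =1 x u -> t = u) ->
  (forall t, ((2 * p)%:Z %| (\sum_i x t i ^+ 2 - s)%R)%Z) ->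
  (forall t u, \sum_i (x t i - x u i) ^+ 2 < (2 * p * m.+1)%:Z) ->
  clique_free_colorable (@distance_graph R n (sqrt_distances R m)) k c ->
  (#|T| <= c * (k * 'C(k * p.-1 + n, k * p.-1)))%N.
Proof.
move=> pp xinj xs xd [f Hf].
have p0 : (0 < p)%N := prime_gt0 pp.
have pR : 0 < (2 * p)%:R :> R by rewrite ltr0n muln_gt0.
have sp : 0 < Num.sqrt (2 * p)%:R :> R by rewrite sqrtr_gt0.
pose nrm t u : int := \sum_i (x t i - x u i) ^+ 2.
pose pt t : 'rV[R]_n := \row_i ((x t i)%:~R / Num.sqrt (2 * p)%:R).
have ptinj : injective pt.
  move=> t u /rowP e; apply: xinj => i; have := e i; rewrite !mxE.
  by move=> /(mulIf (invr_neq0 (lt0r_neq0 sp))) /intr_inj.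
have dist t u : norm2 (pt t - pt u) = Num.sqrt ((nrm t u)%:~R / (2 * p)%:R).
  rewrite /norm2; congr Num.sqrt; rewrite /nrm rmorph_sum mulr_suml.
  apply: eq_bigr => i _; rewrite !mxE -mulrBl exprMn exprVn sqr_sqrtr ?ltW //.
  by rewrite rmorphXn rmorphB.
pose adj : rel T := fun t u => (t != u) && ((2 * p)%:Z %| nrm t u)%Z.
have nrmC t u : nrm t u = nrm u t.
  by apply: eq_bigr => i _; rewrite -sqrrN opprB.
have nrm0 t u : t != u -> 0 < nrm t u.
  move=> tu; rewrite lt_def sumr_ge0 ?andbT; last by move=> i _; exact: sqr_ge0.
  apply: contraNneq tu => e; apply/eqP/xinj => i; apply/eqP.
  move/eqP: e; rewrite psumr_eq0; last by move=> j _; exact: sqr_ge0.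
  by move=> /allP/(_ i (mem_index_enum i)); rewrite /= sqrf_eq0 subr_eq0.
have edge t u : adj t u -> distance_graph (sqrt_distances R m) (pt t) (pt u).
  move=> /andP[tu /dvdzP[j jE]]; have := nrm0 _ _ tu; have := xd t u.
  rewrite -/(nrm t u) jE => j2 j1.
  have j0 : 0 < j by move: j1; rewrite pmulr_lgt0 // ltz_nat muln_gt0.
  exists `|j|%N => /=.
    rewrite absz_gt0 gt_eqF //= -ltnS -ltz_nat gtz0_abs //.
    have : j * (2 * p)%:Z < m.+1%:Z * (2 * p)%:Z by rewrite -PoszM [(m.+1 * _)%N]mulnC.
    by rewrite ltr_pM2r // ltz_nat muln_gt0.
  rewrite dist jE; congr Num.sqrt.
  rewrite rmorphM /= -[X in _ * X / _]pmulrn mulfK ?gt_eqF //.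
  by rewrite -{2}(gtz0_abs j0) -pmulrn.
pose a t (i : 'I_n.+1) : 'F_p :=
  if unlift ord0 i is Some j then - (x t j)%:~R else s%:~R.
pose v t (i : 'I_n.+1) : 'F_p :=
  if unlift ord0 i is Some j then (x t j)%:~R else 1.
have lin t u : (\sum_i a t i * v u i == 0) = (t == u) || adj t u.
  have -> : \sum_i a t i * v u i = (s - \sum_i x t i * x u i)%:~R.
    rewrite big_ord_recl /a /v unlift_none mulr1 rmorphB rmorph_sum -sumrN.
    congr (_ + _); apply: eq_bigr => i _.
    by rewrite liftK rmorphM mulNr.
  rewrite -(dvdz_pcharf (pchar_Fp pp)).
  have -> : (p %| s - \sum_i x t i * x u i)%Z = ((2 * p)%:Z %| nrm t u)%Z.
    (* Both norms agree with s modulo 2p, and the remaining factor 2 cancels against the modulus;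
       this works for p = 2 as well. *)
    have -> : nrm t u = 2 * (s - \sum_i x t i * x u i) +
        ((\sum_i x t i ^+ 2 - s) + (\sum_i x u i ^+ 2 - s)).
      rewrite /nrm; under eq_bigr do rewrite sqrrB.
      rewrite big_split sumrB /= sumrMnl; ring.
    rewrite [RHS]rpredDr; last by rewrite rpredD // xs.
    by rewrite -[RHS]/((2 * p)%:Z %| 2%:Z * (s - \sum_i x t i * x u i)%R)%Z PoszM dvdz_mul2l.
  rewrite /adj; case: (eqVneq t u) => [->|//].
  rewrite /nrm big1 ?dvdz0 // => i _; by rewrite subrr expr0n.
have adjC : symmetric adj by move=> t u; rewrite /adj nrmC eq_sym.
have cls (i : 'I_c) : (#|[set t | f (pt t) == i]| <= k * 'C(k * p.-1 + n, k * p.-1))%N.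
  suff : (#|[set t | f (pt t) == i]| <= k * 'C(k * #|'F_p|.-1 + n, k * #|'F_p|.-1))%N.
    by rewrite card_Fp.
  apply: (clique_free_bound adjC _ lin).
    by move=> u; rewrite /v unlift_none.
  move=> A Ai Ac; rewrite leqNgt; apply/negP => kA; apply: (Hf i).
  have [t0 t0A] : exists t, t \in A by apply/card_gt0P/(leq_trans _ kA).
  pose g (j : nat) := pt (nth t0 (enum A) j).
  have sz : (k.+1 <= size (enum A))%N by rewrite -cardE.
  have gA j : (j < k.+1)%N -> nth t0 (enum A) j \in A.
    by move=> jk; rewrite -mem_enum mem_nth // (leq_trans jk).
  exists [set g j | j in `I_k.+1]%classic; last first.
    by move=> _ [j jk <-] /=; have /fintype.subsetP/(_ _ (gA j jk)) := Ai; rewrite inE => /eqP.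
  split.
    apply: inj_card_eq => j l; rewrite !inE /= => jk lk /ptinj /eqP.
    by rewrite nth_uniq ?enum_uniq ?(leq_trans jk) ?(leq_trans lk) // => /eqP.
  move=> _ _ [j jk <-] [l lk <-] jl; apply: edge; apply: Ac; try exact: gA.
  by apply: contra_notN jl => /eqP e; rewrite /g e.
rewrite -[#|T|]cardsT.
have -> : [set: T] = \bigcup_(i : 'I_c) [set t | f (pt t) == i].
  by apply/setP => t; rewrite !inE; apply/esym/bigcupP; exists (f (pt t)); rewrite ?inE.
apply: leq_trans (_ : \sum_(i < c) k * 'C(k * p.-1 + n, k * p.-1) <= _)%N.
  elim/big_rec2: _ => [|i b A _ bA]; first by rewrite cards0.
  by apply: leq_trans (leq_card_setU _ _) _; rewrite leq_add.
by rewrite sum_nat_const card_ord.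
Qed.

(** A single term in the binomial expansion of (z + (1 - z))^(d + n) = 1. *)
Lemma bin_expr_le (R : realType) (z : R) (d n : nat) : 0 <= z -> z <= 1 ->
  'C(d + n, d)%:R * (z ^+ d * (1 - z) ^+ n) <= 1.
Proof.
move=> z0 z1; have e : (z + (1 - z)) ^+ (d + n) = 1 by rewrite addrC subrK expr1n.
have dn : (n < (d + n).+1)%N by rewrite ltnS leq_addl.
rewrite -[leRHS]e [leRHS]exprDn (bigD1 (Ordinal dn)) //= addnK.
have -> : 'C(d + n, n) = 'C(d + n, d) by rewrite -[LHS]bin_sub ?leq_addl // addnK.
rewrite mulr_natl lerDl; apply: sumr_ge0 => i _.
by rewrite mulrn_wge0 // mulr_ge0 // exprn_ge0 // subr_ge0.
Qed.

(** The grid of mesh 1/M splits by residues mod M into M^n translates of the integer lattice, and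
    each of these by the squared norm of the quotient vector mod 2p. Every class satisfies
    [distance_coloring_bound]; summing over the classes replaces the choice of a good translate. *)
Lemma lattice_coloring_bound (R : realType) (m k n p c M K : nat) (rho : R) :
  prime p -> (0 < M)%N -> 4 * rho < (2 * p * m.+1)%:R ->
  clique_free_colorable (@distance_graph R n (sqrt_distances R m)) k c ->
  (#|[pred y : {ffun 'I_n -> 'I_(2 * K).+1} |
      (\sum_i (((y i)%:R - K%:R) / M%:R : R) ^+ 2 <= rho)%R]|
   <= M ^ n * (2 * p) * (c * (k * 'C(k * p.-1 + n, k * p.-1))))%N.
Proof.
move=> pp M0 rhop col; set P := [pred y | _].
have p2 : (0 < 2 * p)%N by rewrite muln_gt0 (prime_gt0 pp).
have M0' : 0 < M%:R :> R by rewrite ltr0n.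
pose q (y : {ffun 'I_n -> 'I_(2 * K).+1}) (i : 'I_n) := (y i %/ M)%N.
pose r (y : {ffun 'I_n -> 'I_(2 * K).+1}) : {ffun 'I_n -> 'I_M} :=
  [ffun i => Ordinal (ltn_pmod (y i) M0)].
pose s (y : {ffun 'I_n -> 'I_(2 * K).+1}) : 'I_(2 * p) :=
  Ordinal (ltn_pmod (\sum_i q y i ^ 2)%N p2).
pose phi y := (r y, s y).
have -> : (#|P| = \sum_(a : {ffun 'I_n -> 'I_M} * 'I_(2 * p)) #|[pred y | P y & phi y == a]|)%N.
  rewrite -sum1_card (partition_big phi xpredT) //=; apply: eq_bigr => a _.
  by rewrite sum1_card.
apply: leq_trans (_ : \sum_(a : {ffun 'I_n -> 'I_M} * 'I_(2 * p))
    (c * (k * 'C(k * p.-1 + n, k * p.-1))) <= _)%N; last first.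
  by rewrite sum_nat_const card_prod card_ffun !card_ord.
apply: leq_sum => -[a b] _.
pose T := {y : {ffun 'I_n -> 'I_(2 * K).+1} | P y && (phi y == (a, b))}.
have -> : #|[pred y | P y & phi y == (a, b)]| = #|{: T}| by rewrite card_sig.
have TP (t : T) : [/\ (\sum_i (((val t i)%:R - K%:R) / M%:R : R) ^+ 2 <= rho)%R,
    r (val t) = a & s (val t) = b].
  by have /andP[h /eqP[ra sb]] := valP t.
have yE (t : T) i : (val t i : nat) = (q (val t) i * M + a i)%N.
  have [_ ra _] := TP t; have <- : r (val t) i = a i :> nat by rewrite ra.
  by rewrite ffunE /= -divn_eq.
apply: (@distance_coloring_bound R m k n p c T (fun t i => (q (val t) i)%:Z) b%:Z) => //.
- move=> t u e; apply: val_inj; apply/ffunP => i; apply: val_inj.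
  by rewrite /= !yE; have [->] := e i.
- move=> t; have [_ _ sb] := TP t.
  have <- : s (val t) = b :> nat by rewrite sb.
  have -> : (\sum_i (q (val t) i)%:Z ^+ 2 = (\sum_i q (val t) i ^ 2)%N%:Z)%R.
    by rewrite -[RHS]natz natr_sum; apply: eq_bigr => i _; rewrite natrX natz.
  by rewrite -eqz_mod_dvd /= -modz_nat modz_mod.
- move=> t u; rewrite -(ltr_int R); have [ht _ _] := TP t; have [hu _ _] := TP u.
  apply: le_lt_trans rhop.
  (* Two points of a ball of squared radius rho are at squared distance at most 4 rho,
     coordinatewise by (x - y)^2 <= 2 x^2 + 2 y^2. *)
  rewrite rmorph_sum /=; apply: (@le_trans _ _ (2 * rho + 2 * rho)); last by lra.
  apply: le_trans (lerD (ler_wpM2l _ ht) (ler_wpM2l _ hu)) => //.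
  rewrite !mulr_sumr -big_split; apply: ler_sum => i _ /=.
  rewrite rmorphXn rmorphB /= -!pmulrn.
  have -> : (q (val t) i)%:R - (q (val u) i)%:R =
    ((val t i)%:R - K%:R) / M%:R - ((val u i)%:R - K%:R) / M%:R :> R.
    by rewrite !yE !natrD !natrM; field; rewrite gt_eqF.
  move: (_ / _) (_ / _) => x y.
  have := sqr_ge0 (x + y); lra.
Qed.

Local Open Scope classical_set_scope.
Local Open Scope ring_scope.

(** * Moebius and von Mangoldt functions *)

Lemma sum_multiples (V : nmodType) (g : nat -> V) (N d : nat) : (0 < d)%N ->
  \sum_(1 <= n < (N %/ d).+1) g (d * n)%N = \sum_(1 <= l < N.+1 | (d %| l)%N) g l.
Proof.
move=> d0; elim: N => [|N IH]; first by rewrite div0n !big_geq.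
rewrite [RHS]big_mkcond big_nat_recr //= -big_mkcond /= -IH divnS //.
case: ifP => dN; last by rewrite add0n addr0.
rewrite add1n big_nat_recr //=; congr (_ + g _).
by rewrite -[RHS](divnK dN) divnS // dN add1n mulnC.
Qed.

Lemma big_nat_only (V : nmodType) (P : pred nat) (F : nat -> V) (m n j : nat) :
  (m <= j < n)%N -> P j ->
  (forall i, (m <= i < n)%N -> P i -> i != j -> F i = 0) ->
  \sum_(m <= i < n | P i) F i = F j.
Proof.
move=> jmn Pj H; rewrite big_mkcond (bigD1_seq j) ?iota_uniq ?mem_index_iota //=.
rewrite Pj big_nat_cond big1 ?addr0 // => i /andP[imn ij].
by case: ifP => // Pi; apply: H.
Qed.

Lemma sum_hyperbola (V : nmodType) (h : nat -> nat -> V) (N : nat) :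
  \sum_(1 <= d < N.+1) \sum_(1 <= n < (N %/ d).+1) h d (d * n)%N =
  \sum_(1 <= l < N.+1) \sum_(1 <= d < N.+1 | (d %| l)%N) h d l.
Proof.
rewrite (exchange_big_dep_nat xpredT) //=.
by apply: eq_big_nat => d /andP[d0 _]; rewrite -sum_multiples.
Qed.

Lemma sum_divn_swap (V : nmodType) (g : nat -> nat -> V) (N : nat) :
  \sum_(1 <= n < N.+1) \sum_(1 <= e < (N %/ n).+1) g n e =
  \sum_(1 <= e < N.+1) \sum_(1 <= n < (N %/ e).+1) g n e.
Proof.
transitivity (\sum_(1 <= n < N.+1) \sum_(1 <= e < N.+1 | (e * n <= N)%N) g n e).
  apply: eq_big_nat => n /andP[n0 _].
  rewrite (big_nat_widen _ _ N.+1) ?ltnS ?leq_div //.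
  by apply: eq_bigl => e; rewrite ltnS leq_divRL.
rewrite (exchange_big_dep_nat xpredT) //=.
apply: eq_big_nat => e /andP[e0 _].
rewrite [RHS](big_nat_widen _ _ N.+1) ?ltnS ?leq_div //.
by apply: eq_bigl => n; rewrite ltnS leq_divRL // mulnC.
Qed.

Lemma sum_divisors_range (V : nmodType) (f : nat -> V) (n N : nat) :
  (0 < n <= N)%N ->
  \sum_(1 <= d < N.+1 | (d %| n)%N) f d = \sum_(d <- divisors n) f d.
Proof.
move=> /andP[n0 nN]; rewrite -big_filter; apply: perm_big; apply: uniq_perm.
- by rewrite filter_uniq ?iota_uniq.
- exact: divisors_uniq.
move=> d; rewrite mem_filter mem_index_iota -dvdn_divisors //.
case dn: (d %| n)%N => //=; have := dvdn_leq n0 dn; have := dvdn_gt0 n0 dn; lia.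
Qed.

Section MobiusMangoldt.
Variable R : realType.

Definition mangoldt (n : nat) : R :=
  if primes n is [:: p] then ln p%:R else 0.

Definition mobius (n : nat) : R :=
  if (0 < n)%N && all (fun p => logn p n == 1%N) (primes n)
  then (-1) ^+ size (primes n) else 0.

Lemma mangoldt_ge0 n : 0 <= mangoldt n.
Proof.
rewrite /mangoldt; case E: (primes n) => [//|p [|//]].
have : p \in primes n by rewrite E inE.
by rewrite mem_primes => /andP[/prime_gt0 p0 _]; rewrite ln_ge0 // ler1n.
Qed.

Lemma mobius_le1 n : `|mobius n| <= 1.
Proof.
by rewrite /mobius; case: ifP => _; rewrite ?normr0 ?ler01 // normrX normrN1 expr1n.
Qed.

Lemma mobius1 : mobius 1 = 1.
Proof. by rewrite /mobius. Qed.

Lemma mobiusMp p e : prime p -> (0 < e)%N -> ~~ (p %| e)%N ->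
  mobius (p * e) = - mobius e.
Proof.
move=> pp e0 pe; have p0 := prime_gt0 pp.
have pr : perm_eq (primes (p * e)) (p :: primes e).
  apply: uniq_perm; rewrite ?primes_uniq //= ?primes_uniq ?mem_primes ?pp ?e0 /= ?pe //.
  by move=> q; rewrite primesM // inE primes_prime // inE.
rewrite /mobius muln_gt0 p0 e0 /= (perm_all _ pr) (perm_size pr) /=.
rewrite lognM // (logn_prime _ pp) eqxx.
have -> : logn p e = 0%N by rewrite lognE pp e0 /= (negbTE pe).
rewrite addn0 eqxx /=.
have -> : all (fun q => logn q (p * e) == 1%N) (primes e) =
          all (fun q => logn q e == 1%N) (primes e).
  apply: eq_in_all => q; rewrite mem_primes => /and3P[pq _ qe].
  rewrite lognM // (logn_prime _ pp).
  by have /negbTE -> : q != p by apply: contraNneq pe => <-.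
by case: ifP => _; rewrite ?oppr0 // exprS mulN1r.
Qed.

Lemma mobius_sq p d : prime p -> (p * p %| d)%N -> mobius d = 0.
Proof.
move=> pp ppd; rewrite /mobius; case: ifP => // /andP[d0 /allP H].
have /H : p \in primes d by rewrite mem_primes pp d0 (dvdn_trans _ ppd) ?dvdn_mulr.
have : (2 <= logn p d)%N by rewrite -pfactor_dvdn // expnS expn1.
by move=> + /eqP => /[swap] ->.
Qed.

(** With p a prime factor of n, the divisors prime to p are those of the p-free part m, and each
    such e cancels against p e. Divisors divisible by p^2 contribute 0. *)
Lemma sum_mobius n : (0 < n)%N ->
  \sum_(d <- divisors n) mobius d = (n == 1%N)%:R.
Proof.
move=> n0; have [->|n1] := eqVneq n 1%N.
  by rewrite (_ : divisors 1 = [:: 1%N]) // big_seq1 mobius1.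
have pp : prime (pdiv n) by rewrite pdiv_prime //; lia.
set p := pdiv n in pp; have p0 := prime_gt0 pp.
have [m pm nE] := pfactor_coprime pp n0.
have a0 : (0 < logn p n)%N by rewrite -pfactor_dvdn // expn1 pdiv_dvd.
set a := logn p n in nE a0.
have m0 : (0 < m)%N by move: n0; rewrite nE muln_gt0 => /andP[].
have mn : (m %| n)%N by rewrite nE dvdn_mulr.
have pnm : ~~ (p %| m)%N by rewrite -prime_coprime.
have key d : ~~ (p %| d)%N -> (d %| n)%N = (d %| m)%N.
  by move=> pd; rewrite nE Gauss_dvdl // coprime_sym coprimeXl // prime_coprime.
rewrite (bigID (fun d => (p %| d)%N)) /= addrC.
have -> : \sum_(d <- divisors n | ~~ (p %| d)%N) mobius d = \sum_(d <- divisors m) mobius d.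
  rewrite -big_filter; apply: perm_big; apply: uniq_perm.
  - by rewrite filter_uniq ?divisors_uniq.
  - exact: divisors_uniq.
  move=> d; rewrite mem_filter -!dvdn_divisors //.
  have [pd|pd] /= := boolP (p %| d)%N; last exact: key.
  by apply/esym/negbTE; apply: contra pnm => /(dvdn_trans pd).
rewrite [X in _ + X](bigID (fun d => p * p %| d)%N) /= [X in _ + (X + _)]big1 ?add0r; last first.
  by move=> d /andP[_ pd]; rewrite (mobius_sq pp).
have -> : \sum_(d <- divisors n | (p %| d)%N && ~~ (p * p %| d)%N) mobius d =
    \sum_(d <- [seq (p * e)%N | e <- divisors m]) mobius d.
  rewrite -big_filter; apply: perm_big; apply: uniq_perm.
  - by rewrite filter_uniq ?divisors_uniq.
  - by rewrite map_inj_uniq ?divisors_uniq // => x y /eqP; rewrite eqn_pmul2l // => /eqP.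
  move=> d; rewrite mem_filter -!dvdn_divisors //.
  apply/idP/mapP => [/andP[/andP[/dvdnP[e ->]]]|[e + ->]].
    rewrite mulnC dvdn_pmul2l // => pe en; exists e => //.
    rewrite -dvdn_divisors // -key //.
    by rewrite (dvdn_trans _ en) ?dvdn_mull.
  rewrite -dvdn_divisors // dvdn_mulr //= dvdn_pmul2l // => em.
  rewrite (contra (fun pe => dvdn_trans pe em) pnm) /=.
  rewrite nE mulnC dvdn_mul // -{1}[p]expn1; exact: dvdn_exp2l.
rewrite big_map -big_split big_seq big1 //= => d.
rewrite -dvdn_divisors // => dm; rewrite mobiusMp ?subrr //.
- exact: dvdn_gt0 dm.
- by apply: contra pnm => /dvdn_trans; apply.
Qed.

Lemma ln_prod (I : eqType) (r : seq I) (F : I -> R) :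
  (forall i, i \in r -> 0 < F i) ->
  ln (\prod_(i <- r) F i) = \sum_(i <- r) ln (F i).
Proof.
elim: r => [|i r IH] H; first by rewrite !big_nil ln1.
have H' j : j \in r -> 0 < F j by move=> jr; rewrite H // inE jr orbT.
rewrite !big_cons lnM ?IH // posrE; first by rewrite H ?mem_head.
by rewrite big_seq prodr_gt0.
Qed.

(** Each prime p contributes ln p once for each of the powers p, ..., p^([logn p n]) dividing n. *)
Lemma sum_mangoldt n : (0 < n)%N ->
  \sum_(d <- divisors n) mangoldt d = ln n%:R.
Proof.
move=> n0.
have -> : ln (n%:R : R) = \sum_(p <- primes n) (logn p n)%:R * ln p%:R.
  rewrite {1}(prod_prime_decomp n0) prime_decompE big_map /=.
  rewrite natr_prod ln_prod; last first.
    by move=> p; rewrite mem_primes => /andP[/prime_gt0 p0 _]; rewrite ltr0n expn_gt0 p0.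
  apply: eq_big_seq => p; rewrite mem_primes => /andP[/prime_gt0 p0 _].
  by rewrite natrX lnXn ?ltr0n // mulr_natl.
transitivity (\sum_(d <- divisors n) \sum_(p <- primes n)
    (if primes d == [:: p] then ln (p%:R : R) else 0)).
  apply: eq_big_seq => d; rewrite -dvdn_divisors // => dn.
  rewrite /mangoldt; case E: (primes d) => [|p [|q s]].
  - by rewrite big1.
  - have pn : p \in primes n.
      have : p \in primes d by rewrite E inE.
      by rewrite !mem_primes n0 => /and3P[-> _ /= pd]; apply: dvdn_trans pd dn.
    rewrite (bigD1_seq p) ?primes_uniq //= eqxx big1 ?addr0 // => q qp.
    by rewrite eqseq_cons eq_sym (negbTE qp).
  - by rewrite big1 // => x _; rewrite eqseq_cons andbF.
rewrite exchange_big /=; apply: eq_big_seq => p pn.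
have pp : prime p by move: pn; rewrite mem_primes => /andP[].
rewrite -big_mkcond /= big_const_seq iter_addr addr0 mulr_natl; congr (_ *+ _).
rewrite -size_filter.
have /perm_size -> : perm_eq [seq d <- divisors n | primes d == [:: p]]
    [seq (p ^ j)%N | j <- iota 1 (logn p n)].
  apply: uniq_perm.
  - by rewrite filter_uniq ?divisors_uniq.
  - rewrite map_inj_in_uniq ?iota_uniq // => i j _ _ /eqP.
    by rewrite eqn_exp2l ?prime_gt1 // => /eqP.
  move=> d; rewrite mem_filter -dvdn_divisors //.
  apply/idP/mapP => [/andP[/eqP pd dn]|[j + ->]].
    have d0 := dvdn_gt0 n0 dn.
    have dE : d = (p ^ logn p d)%N.
      by rewrite {1}(prod_prime_decomp d0) prime_decompE big_map /= pd big_seq1.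
    exists (logn p d) => //.
    have : p \in primes d by rewrite pd inE.
    rewrite -logn_gt0 mem_iota => ->; rewrite add1n ltnS /=.
    by rewrite -pfactor_dvdn // -dE.
  rewrite mem_iota add1n ltnS => /andP[j0 jl].
  by rewrite primesX // primes_prime // eqxx pfactor_dvdn.
by rewrite size_map size_iota.
Qed.

(** Moebius inversion of [sum_mangoldt] gives the sum of mu(d) ln(l/d) as Lambda(l). Writing ln d =
    ln l - ln(l/d), the part with ln l vanishes: the sum of mu is 0 unless l = 1, and then ln l =
    0. *)
Lemma sum_mobius_ln l N : (0 < l <= N)%N ->
  \sum_(1 <= d < N.+1 | (d %| l)%N) mobius d * ln d%:R = - mangoldt l.
Proof.
move=> /andP[l0 lN].
have lnl : \sum_(1 <= d < N.+1 | (d %| l)%N) mobius d * ln (l %/ d)%:R = mangoldt l.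
  transitivity (\sum_(1 <= d < N.+1 | (d %| l)%N) \sum_(1 <= e < N.+1 | (e * d %| l)%N)
     mobius d * mangoldt e).
    rewrite big_nat_cond [RHS]big_nat_cond; apply: eq_bigr => d /andP[/andP[d0 _] dl].
    have ld0 : (0 < l %/ d)%N by rewrite divn_gt0 // dvdn_leq.
    rewrite -sum_mangoldt // -(@sum_divisors_range _ _ _ N).
      rewrite mulr_sumr; apply: eq_bigl => e.
      by rewrite -{2}(divnK dl) dvdn_pmul2r.
    by rewrite ld0 (leq_trans _ lN) // leq_div.
  rewrite (exchange_big_dep_nat (fun e => (e %| l)%N)) /=; last first.
    by move=> d e _ _ dl; apply: dvdn_trans; rewrite dvdn_mulr.
  rewrite (@big_nat_only _ _ _ _ _ l) ?dvdnn ?l0 ?ltnS //=.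
    rewrite (eq_bigl (fun d => d == 1%N)); last first.
      move=> d; have -> : (l * d %| l)%N = (d %| 1)%N by rewrite -{2}[l]muln1 dvdn_pmul2l.
      rewrite dvdn1; by case: eqP => [->|]; rewrite ?andbF // dvd1n.
    by rewrite (@big_nat_only _ _ _ _ _ 1%N) ?mobius1 ?mul1r ?ltnS ?(leq_trans l0 lN) // => i _ ->.
  move=> e /andP[e0 _] el enl.
  rewrite -mulr_suml (eq_bigl (fun d => (d %| l %/ e)%N)).
    rewrite sum_divisors_range ?sum_mobius.
    - suff -> : (l %/ e == 1)%N = false by rewrite mul0r.
      apply/negbTE; apply: contra enl => /eqP H.
      by rewrite -(divnK el) H mul1n.
    - by rewrite divn_gt0 // dvdn_leq.
    - by rewrite divn_gt0 // dvdn_leq // (leq_trans _ lN) // leq_div.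
  move=> d; have -> : (e * d %| l)%N = (d %| l %/ e)%N.
    by rewrite -{1}(divnK el) [(e * d)%N]mulnC dvdn_pmul2r.
  case H: ((d %| l %/ e)%N); rewrite ?andbF // andbT.
  by rewrite -(divnK el) dvdn_mulr.
rewrite -lnl -sumrN.
have -> : \sum_(1 <= i < N.+1 | (i %| l)%N) - (mobius i * ln (l %/ i)%:R) =
  \sum_(1 <= i < N.+1 | (i %| l)%N) (mobius i * ln i%:R - mobius i * ln l%:R).
  rewrite big_nat_cond [RHS]big_nat_cond; apply: eq_bigr => d /andP[/andP[d0 _] dl].
  rewrite -mulrBr -mulrN; congr (_ * _).
  have ld0 : (0 < l %/ d)%N by rewrite divn_gt0 // dvdn_leq.
  by rewrite -{2}(divnK dl) natrM lnM ?posrE ?ltr0n // opprD addrCA subrr addr0.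
rewrite sumrB -mulr_suml [X in _ - X * _]sum_divisors_range ?l0 // sum_mobius //.
by case: eqP => [->|_]; rewrite ?ln1 ?mulr0 ?mul0r subr0.
Qed.

End MobiusMangoldt.

(** * Chebyshev, Mertens and Selberg *)

Section Selberg.
Variable R : realType.
Local Notation mangoldt := (@mangoldt R).
Local Notation mobius := (@mobius R).

Definition psi (N : nat) : R := \sum_(1 <= n < N.+1) mangoldt n.
Definition lnfact (N : nat) : R := \sum_(1 <= l < N.+1) ln l%:R.
Definition harmsum (N : nat) : R := \sum_(1 <= n < N.+1) n%:R^-1.

Lemma ln_step (N : nat) : (0 < N)%N ->
  (N.+1%:R^-1 : R) <= ln (N.+1%:R : R) - ln (N%:R : R) <= (N%:R : R)^-1.
Proof.
move=> N0; have n0 : 0 < N%:R :> R by rewrite ltr0n.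
have n1 : 0 < N.+1%:R :> R by rewrite ltr0n.
rewrite -ln_div ?posrE //; apply/andP; split; last first.
  have -> : N.+1%:R / N%:R = 1 + N%:R^-1 :> R by rewrite -natr1; field; lra.
  by apply: le_ln1Dx; rewrite (lt_trans (ltrN10 _)) // invr_gt0.
rewrite -[leRHS]opprK -lnV ?posrE ?divr_gt0 // lerNr invf_div.
have -> : N%:R / N.+1%:R = 1 + - N.+1%:R^-1 :> R by rewrite -natr1; field; lra.
by apply: le_ln1Dx; rewrite ltrN2 invf_lt1 // ltr1n ltnS.
Qed.

Lemma lnfact_bounds (N : nat) : (0 < N)%N ->
  N%:R * ln (N%:R : R) - N%:R <= lnfact N <= N%:R * ln (N%:R : R) - N%:R + 1 + ln (N%:R : R).
Proof.
elim: N => // -[_ _|N IH _].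
  by rewrite /lnfact big_nat1 ln1; lra.
have /andP[l1 l2] := IH isT; have /andP[s1 s2] := @ln_step N.+1 isT.
rewrite /lnfact big_nat_recr //= -/(lnfact N.+1).
move: l1 l2 s1 s2; set a := ln (N.+1%:R : R); set b := ln (N.+2%:R : R).
have -> : N.+2%:R = N.+1%:R + 1 :> R by rewrite natr1.
set x := (N.+1%:R : R) => l1 l2 s1 s2.
have x0 : 0 < x by rewrite ltr0n.
have s1' : 1 <= (x + 1) * (b - a) by rewrite -ler_pdivrMl ?mulr1 //; lra.
have s2' : x * (b - a) <= 1 by rewrite -ler_pdivlMl ?mulr1 //; lra.
apply/andP; split; nra.
Qed.

(** Here g is Euler's constant: the supremum of the increasing sequence v_N = u_N - 1/N, which stays
    below the decreasing sequence u_N = H_N - ln N. *)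
Lemma harmsum_bounds : exists g : R, forall N : nat, (0 < N)%N ->
  0 <= harmsum N - ln N%:R - g <= N%:R^-1.
Proof.
pose u (N : nat) : R := harmsum N - ln N%:R.
pose v (N : nat) : R := u N - N%:R^-1.
have HS (N : nat) : harmsum N.+1 = harmsum N + N.+1%:R^-1.
  by rewrite /harmsum big_nat_recr.
have uS (N : nat) : u N.+2 <= u N.+1.
  rewrite /u HS; have /andP[] := @ln_step N.+1 isT.
  move: (ln _) (ln _) (harmsum _) (N.+1%:R^-1) (N.+2%:R^-1) => a b c d e; lra.
have vS (N : nat) : v N.+1 <= v N.+2.
  rewrite /v /u (HS N.+1); have /andP[] := @ln_step N.+1 isT.
  move: (ln _) (ln _) (harmsum _) (N.+1%:R^-1) (N.+2%:R^-1) => a b c d e; lra.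
have umono (i j : nat) : (i <= j)%N -> u j.+1 <= u i.+1.
  by elim: j => [|j IH]; rewrite leq_eqVlt => /predU1P[->//|]; rewrite // ltnS => /IH; apply: le_trans.
have vmono (i j : nat) : (i <= j)%N -> v i.+1 <= v j.+1.
  elim: j => [|j IH]; rewrite leq_eqVlt => /predU1P[->//|]; rewrite // ltnS => /IH h.
  exact: le_trans (vS j).
have vu (i j : nat) : v i.+1 <= u j.+1.
  apply: (@le_trans _ _ (v (maxn i j).+1)); first by rewrite vmono ?leq_maxl.
  apply: (@le_trans _ _ (u (maxn i j).+1)); last by rewrite umono ?leq_maxr.
  by rewrite /v gerBl invr_ge0.
pose A := range (fun i : nat => v i.+1).
exists (sup A) => -[//|N] _.
have Av : has_ubound A by exists (u 1%N) => _ [i _ <-].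
have h1 : sup A <= u N.+1.
  by apply: ge_sup; [exists (v 1%N), 0%N | move=> _ [i _ <-]].
have h2 : v N.+1 <= sup A by apply: ub_le_sup => //; exists N.
move: h1 h2; rewrite /v /u; move: (sup A) (ln _) (harmsum _) (N.+1%:R^-1) => a b c d h1 h2.
by apply/andP; split; lra.
Qed.

Lemma sum_mangoldt_divn N :
  \sum_(1 <= e < N.+1) mangoldt e * (N %/ e)%:R = lnfact N.
Proof.
transitivity (\sum_(1 <= e < N.+1) \sum_(1 <= n < (N %/ e).+1) mangoldt e).
  by apply: eq_bigr => e _; rewrite sumr_const_nat subn1 mulr_natr.
rewrite (sum_hyperbola (fun e _ => mangoldt e)).
apply: eq_big_nat => l /andP[l0 lN].
by rewrite sum_divisors_range ?l0 // sum_mangoldt.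
Qed.

Lemma sum_psi_divn N : \sum_(1 <= n < N.+1) psi (N %/ n) = lnfact N.
Proof.
rewrite /psi (sum_divn_swap (fun n e => mangoldt e)) -sum_mangoldt_divn.
by apply: eq_bigr => e _; rewrite sumr_const_nat subn1 mulr_natr.
Qed.

Lemma psi_ge0 N : 0 <= psi N.
Proof. by apply: sumr_ge0 => n _; exact: mangoldt_ge0. Qed.

Lemma psi_mono M N : (M <= N)%N -> psi M <= psi N.
Proof.
move=> MN; rewrite /psi [leRHS](@big_cat_nat _ _ _ M.+1) //= lerDl.
by apply: sumr_ge0 => n _; exact: mangoldt_ge0.
Qed.

(** Chebyshev's argument: in ln N! - 2 ln M!, with M the half of N, the coefficient of Lambda(e) is
    the parity of floor(N/e), hence nonnegative, and it is 1 for M < e <= N. Weak Stirling bounds do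
    the rest. *)
Lemma psi_half N : (1 < N)%N -> psi N - psi (N %/ 2) <= 5 * N%:R.
Proof.
move=> N1; have M0 : (0 < N %/ 2)%N by rewrite divn_gt0.
set M := (N %/ 2)%N in M0 *.
have MN : (M <= N)%N by rewrite leq_div.
have /andP[Mb1 Mb2] : (2 * M <= N <= 2 * M + 1)%N by rewrite /M; clear; lia.
apply: (@le_trans _ _ (lnfact N - 2 * lnfact M)).
  have -> : lnfact M = \sum_(1 <= e < N.+1) mangoldt e * (M %/ e)%:R.
    rewrite -sum_mangoldt_divn [RHS](@big_cat_nat _ _ _ M.+1) //=.
    rewrite [X in _ + X]big_nat_cond [X in _ + X]big1 ?addr0 // => e.
    by case/andP => /andP[Me _] _; rewrite divn_small // mulr0.
  rewrite -sum_mangoldt_divn mulr_sumr -sumrB.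
  have -> : psi N - psi M = \sum_(1 <= e < N.+1) (if (M < e)%N then mangoldt e else 0).
    rewrite /psi !(@big_cat_nat _ _ _ M.+1 1 N.+1) //= addrAC subrr add0r.
    rewrite [X in _ = X + _]big_nat_cond [X in _ = X + _]big1; last first.
      by move=> e /andP[/andP[_]]; rewrite ltnS ltnNge => ->.
    by rewrite add0r; apply: eq_big_nat => e /andP[-> _].
  apply: ler_sum_nat => e /andP[e0 eN].
  have -> : (M %/ e)%N = (N %/ e %/ 2)%N by rewrite /M -!divnMA mulnC.
  have -> : mangoldt e * (N %/ e)%:R - 2 * (mangoldt e * (N %/ e %/ 2)%:R) =
    mangoldt e * ((N %/ e) %% 2)%:R.
    by rewrite {1}(divn_eq (N %/ e) 2) natrD natrM; ring.
  case: ifP => [Me|_]; last by rewrite mulr_ge0 ?mangoldt_ge0.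
  have -> : (N %/ e = 1)%N.
    apply/eqP; rewrite eqn_leq divn_gt0 // [(e <= N)%N]eN andbT -ltnS ltn_divLR //.
    by move: Me Mb2; clear; lia.
  by rewrite mulr1.
have /andP[_ u] := @lnfact_bounds N (ltnW N1).
have /andP[l _] := @lnfact_bounds M M0.
have n0 : 0 < N%:R :> R by rewrite ltr0n ltnW.
have m0 : 0 < M%:R :> R by rewrite ltr0n.
have lnN : ln (N%:R : R) <= N%:R by exact/ltW/ln_sublinear.
have ln3 : ln (3 : R) < 3 by exact: ln_sublinear.
have lnN0 : 0 <= ln (N%:R : R) by rewrite ln_ge0 // ler1n ltnW.
have lnM0 : 0 <= ln (M%:R : R) by rewrite ln_ge0 // ler1n.
have lnM : ln (N%:R : R) - ln 3 <= ln (M%:R : R).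
  rewrite lerBlDr -lnM ?posrE // ler_ln ?posrE ?mulr_gt0 // -natrM ler_nat.
  by move: N1 Mb1 Mb2; clear; lia.
have M1 : N%:R - 1 <= 2 * M%:R :> R.
  by rewrite lerBlDr -natrM natr1 ler_nat -addn1.
have M2 : 2 * M%:R <= N%:R :> R by rewrite -natrM ler_nat.
have N1' : 1 <= N%:R :> R by rewrite ler1n ltnW.
have : (N%:R - 1) * (ln (N%:R : R) - ln 3) <= 2 * M%:R * ln M%:R.
  have [h|h] := leP 0 (ln (N%:R : R) - ln 3).
    by apply: ler_pM => //; lra.
  apply: (@le_trans _ _ 0); last by rewrite !mulr_ge0 // ltW.
  by rewrite mulr_ge0_le0 //; lra.
have : (N%:R - 1) * ln 3 <= (N%:R - 1) * 3 :> R by rewrite ler_wpM2l //; lra.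
lra.
Qed.

Lemma psi_le N : psi N <= 10 * N%:R.
Proof.
elim/ltn_ind: N => N IH.
case: (leqP N 1%N) => [N1|N1].
  have -> : psi N = 0; last by rewrite mulr_ge0.
  case: N N1 {IH} => [|[|//]] _; rewrite /psi; first by rewrite big_geq.
  by rewrite big_nat1.
have h := psi_half N1; have := IH (N %/ 2)%N.
rewrite ltn_Pdiv ?(ltnW N1) // => /(_ isT) h2.
have : 2 * (N %/ 2)%:R <= N%:R :> R by rewrite -natrM ler_nat; lia.
lra.
Qed.

(** Replacing floor(N/e) by N/e in the formula for ln N! costs at most psi(N) <= 10 N; Stirling's
    error accounts for the remaining 1. *)
Lemma mertens (N : nat) : (0 < N)%N ->
  `|\sum_(1 <= e < N.+1) mangoldt e / e%:R - ln N%:R| <= 11.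
Proof.
move=> N0; have n0 : 0 < N%:R :> R by rewrite ltr0n.
set S := \sum_(_ <= _ < _) _.
have /andP[l1 l2] := lnfact_bounds N0.
have lnN : ln (N%:R : R) <= N%:R by exact/ltW/ln_sublinear.
have p := psi_le N.
have hl : lnfact N <= N%:R * S.
  rewrite -sum_mangoldt_divn mulr_sumr; apply: ler_sum_nat => e /andP[e0 _].
  rewrite mulrCA ler_wpM2l ?mangoldt_ge0 // ler_pdivlMr ?ltr0n // -natrM ler_nat.
  exact: leq_divM.
have hu : N%:R * S <= lnfact N + psi N.
  rewrite -sum_mangoldt_divn mulr_sumr -big_split /=; apply: ler_sum_nat => e /andP[e0 _].
  rewrite mulrCA -{3}[mangoldt e]mulr1 -mulrDr ler_wpM2l ?mangoldt_ge0 //.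
  rewrite ler_pdivrMr ?ltr0n // natr1 -natrM ler_nat ltnW //.
  by rewrite mulSn {1}(divn_eq N e) addnC ltn_add2r ltn_pmod.
have N1 : 1 <= N%:R :> R by rewrite ler1n.
rewrite ler_norml; apply/andP; split.
  rewrite -(ler_pM2l n0); lra.
rewrite -(ler_pM2l n0); lra.
Qed.

Lemma sum_inv_sqrt N :
  \sum_(1 <= d < N.+1) (Num.sqrt (d%:R : R))^-1 <= 2 * Num.sqrt N%:R.
Proof.
elim: N => [|N IH]; first by rewrite big_geq // sqrtr0 mulr0.
rewrite big_nat_recr //=.
have a0 : 0 <= Num.sqrt (N%:R : R) by rewrite sqrtr_ge0.
have b0 : 0 < Num.sqrt (N.+1%:R : R) by rewrite sqrtr_gt0 ltr0n.
have a2 : Num.sqrt (N%:R : R) ^+ 2 = N%:R by rewrite sqr_sqrtr.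
have b2 : Num.sqrt (N.+1%:R : R) ^+ 2 = N%:R + 1 by rewrite sqr_sqrtr // natr1.
move: IH a0 b0 a2 b2; move: (\sum_(_ <= _ < _) _) (Num.sqrt N%:R) (Num.sqrt N.+1%:R).
move=> S a b IH a0 b0 a2 b2; apply: le_trans (lerD IH (lexx _)) _.
rewrite -lerBrDl -(ler_pM2r b0) mulVf ?gt_eqF //; nra.
Qed.

Lemma ln_le_sqrt (y : R) : 0 < y -> ln y <= 2 * Num.sqrt y.
Proof.
move=> y0; rewrite -{1}(sqr_sqrtr (ltW y0)) lnXn ?sqrtr_gt0 // mulr_natl.
by rewrite lerMn2r /= ltW // ln_sublinear // sqrtr_gt0.
Qed.

Lemma sqr_ln_le_sqrt (y : R) : 1 <= y -> ln y ^+ 2 <= 16 * Num.sqrt y.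
Proof.
move=> y1; have y0 : 0 < y by lra.
have s0 : 0 < Num.sqrt y by rewrite sqrtr_gt0.
have l : ln y <= 4 * Num.sqrt (Num.sqrt y).
  have -> : ln y = 2 * ln (Num.sqrt y).
    by rewrite -{1}(sqr_sqrtr (ltW y0)) lnXn // mulr_natl.
  by have := ln_le_sqrt s0; lra.
have l0 : 0 <= ln y by rewrite ln_ge0.
have -> : 16 * Num.sqrt y = (4 * Num.sqrt (Num.sqrt y)) ^+ 2.
  by rewrite exprMn (sqr_sqrtr (ltW s0)) -natrX.
by rewrite lerXn2r ?nnegrE //; apply: le_trans l.
Qed.

(** The constant g + 1 is the one that cancels the linear terms: with M = floor(N/d), M ln M - M
    comes from ln M! and -M (ln M + g) from the harmonic sum. What remains is O(1 + ln M). A bound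
    by a square root is enough, since the sum of 1/sqrt(d) over d <= N is O(sqrt N). *)
Lemma selberg_remainder : exists2 K : R, 0 <= K & exists g : R, forall N d : nat,
  (0 < d <= N)%N ->
  `|ln (N%:R / d%:R) * \sum_(1 <= n < (N %/ d).+1)
     (psi (N %/ d %/ n) - N%:R / (d * n)%:R + (g + 1))| <= K * Num.sqrt (N%:R / d%:R).
Proof.
have [g hg] := harmsum_bounds.
have g0 := normr_ge0 g.
(* From ln y <= 2 sqrt y and (ln y)^2 <= 16 sqrt y, applied to ln y (3 + 2|g| + 2 ln y). *)
exists ((3 + 2 * `|g|) * 2 + 2 * 16); first by lra.
exists g => N d /andP[d0 dN].
set y := N%:R / d%:R; set M := (N %/ d)%N.
have M0 : (0 < M)%N by rewrite divn_gt0.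
have d0' : 0 < d%:R :> R by rewrite ltr0n.
have My : M%:R <= y by rewrite ler_pdivlMr // -natrM ler_nat leq_divM.
have yM : y <= M%:R + 1.
  by rewrite ler_pdivrMr // natr1 -natrM ler_nat ltnW // ltn_ceil.
have M1 : 1 <= M%:R :> R by rewrite ler1n.
have y1 : 1 <= y by apply: le_trans My.
have lM0 : 0 <= ln (M%:R : R) by rewrite ln_ge0.
have lMy : ln (M%:R : R) <= ln y by rewrite ler_ln ?posrE //; lra.
have -> : \sum_(1 <= n < M.+1) (psi (M %/ n) - N%:R / (d * n)%:R + (g + 1)) =
    lnfact M - y * harmsum M + (g + 1) * M%:R.
  rewrite big_split sumrB /= sum_psi_divn sumr_const_nat subn1 mulr_natr.
  rewrite /harmsum mulr_sumr; congr (_ - _ + _).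
  by apply: eq_bigr => n _; rewrite natrM invfM mulrA.
have /andP[l1 l2] := lnfact_bounds M0.
have /andP[h1 h2] := hg M M0.
have h3 : M%:R * (harmsum M - ln M%:R - g) <= 1.
  by rewrite -ler_pdivlMl ?mulr1 //; lra.
have h4 : 0 <= M%:R * (harmsum M - ln M%:R - g) by rewrite mulr_ge0.
have h5 : M%:R^-1 <= 1 :> R by rewrite invf_le1 //; lra.
have /andP[g1 g2] : - `|g| <= g <= `|g| by rewrite -ler_norml.
have b : `|lnfact M - y * harmsum M + (g + 1) * M%:R| <= 3 + 2 * `|g| + 2 * ln M%:R.
  have th0 : 0 <= y - M%:R by lra.
  have t1 : (y - M%:R) * harmsum M <= harmsum M + `|g|.
    have [h|h] := leP 0 (harmsum M).
      by apply: le_trans (_ : harmsum M <= _); [rewrite ler_piMl //; lra | lra].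
    apply: (@le_trans _ _ 0); last by lra.
    by rewrite mulr_ge0_le0 // ltW.
  have t2 : - `|g| <= (y - M%:R) * harmsum M.
    have [h|h] := leP 0 (harmsum M).
      by apply: (@le_trans _ _ 0); [lra | rewrite mulr_ge0].
    have : 0 <= (1 - (y - M%:R)) * (- harmsum M) by rewrite mulr_ge0 //; lra.
    by lra.
  have -> : lnfact M - y * harmsum M + (g + 1) * M%:R =
    (lnfact M - (M%:R * ln M%:R - M%:R)) - M%:R * (harmsum M - ln M%:R - g)
     - (y - M%:R) * harmsum M by ring.
  rewrite ler_norml; apply/andP; split; lra.
have ly0 : 0 <= ln y by lra.
rewrite normrM (ger0_norm ly0).
apply: (@le_trans _ _ (ln y * (3 + 2 * `|g| + 2 * ln y))).
  by rewrite ler_wpM2l //; apply: (le_trans b); lra.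
have -> : ln y * (3 + 2 * `|g| + 2 * ln y) = (3 + 2 * `|g|) * ln y + 2 * ln y ^+ 2 by ring.
have s1 := sqr_ln_le_sqrt y1.
have s2 : (3 + 2 * `|g|) * ln y <= (3 + 2 * `|g|) * (2 * Num.sqrt y).
  by rewrite ler_wpM2l ?ln_le_sqrt //; lra.
lra.
Qed.

(* Tatuzawa-Iseki: apply the Moebius-type identity
   [sum_(d n = l) mu(d) ln(N/d) F(l) = F(1) ln N + sum_l Lambda(l) F(l)]
   to [F(l) = psi(N/l) - N/l + (gamma + 1)], whose divisor sums are O(log). *)
Lemma selberg : exists B : R, forall N : nat, (0 < N)%N ->
  `|psi N * ln N%:R + \sum_(1 <= l < N.+1) mangoldt l * psi (N %/ l)
    - 2 * N%:R * ln N%:R| <= B * N%:R.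
Proof.
have [K K0 [g H]] := selberg_remainder.
(* The three terms bound the divisor sums, the error in Mertens' estimate, and g + 1 times psi(N) +
   ln N <= 11 N. *)
exists (2 * K + 11 + 11 * `|g + 1|) => N N0.
have n0 : 0 < N%:R :> R by rewrite ltr0n.
have N1 : 1 <= N%:R :> R by rewrite ler1n.
pose F (l : nat) : R := psi (N %/ l) - N%:R / l%:R + (g + 1).
pose h (d l : nat) := mobius d * ln (N%:R / d%:R) * F l.
have T1 : \sum_(1 <= d < N.+1) \sum_(1 <= n < (N %/ d).+1) h d (d * n)%N =
    ln N%:R * F 1%N + \sum_(1 <= l < N.+1) mangoldt l * F l.
  rewrite (sum_hyperbola h).
  transitivity (\sum_(1 <= l < N.+1) (((l == 1%N)%:R * ln N%:R) * F l + mangoldt l * F l)).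
    apply: eq_big_nat => l /andP[l0 lN].
    rewrite /h -mulr_suml -mulrDl; congr (_ * _).
    rewrite -sum_mobius // -(@sum_divisors_range _ _ _ N) ?l0 //.
    rewrite -[mangoldt l]opprK -(@sum_mobius_ln _ _ N) ?l0 // mulr_suml -sumrB.
    rewrite big_nat_cond [RHS]big_nat_cond; apply: eq_bigr => d /andP[/andP[d0 _] _].
    by rewrite ln_div ?posrE ?ltr0n // mulrBr.
  rewrite big_split /=; congr (_ + _).
  rewrite (bigD1_seq 1%N) ?iota_uniq ?mem_index_iota ?ltnS //= mul1r big1 ?addr0 // => l.
  by move=> /negbTE ->; rewrite !mul0r.
have T2 : `|\sum_(1 <= d < N.+1) \sum_(1 <= n < (N %/ d).+1) h d (d * n)%N| <=
    2 * K * N%:R.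
  apply: le_trans (ler_norm_sum _ _ _) _.
  apply: (@le_trans _ _ (\sum_(1 <= d < N.+1) K * (Num.sqrt N%:R * (Num.sqrt d%:R)^-1))).
    apply: ler_sum_nat => d /andP[d0 dN].
    rewrite /h -mulr_sumr -mulrA normrM -[leRHS]mul1r.
    apply: ler_pM => //; first exact: mobius_le1.
    rewrite -sqrtrV ?ler0n // -sqrtrM ?ler0n //.
    under eq_bigr do rewrite /F divnMA.
    by apply: H; rewrite d0.
  rewrite -!mulr_sumr.
  have := ler_wpM2l (sqrtr_ge0 (N%:R : R)) (sum_inv_sqrt N).
  rewrite [leRHS]mulrCA -expr2 sqr_sqrtr ?ler0n // => /(ler_wpM2l K0) /le_trans; apply.
  by rewrite mulrCA mulrA.
have m := mertens N0.
have p := psi_le N; have p0 := psi_ge0 N.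
have lnN0 : 0 <= ln (N%:R : R) by rewrite ln_ge0.
have lnN : ln (N%:R : R) <= N%:R by exact/ltW/ln_sublinear.
have S2 : \sum_(1 <= l < N.+1) mangoldt l * F l =
   \sum_(1 <= l < N.+1) mangoldt l * psi (N %/ l)
   - N%:R * (\sum_(1 <= l < N.+1) mangoldt l / l%:R) + (g + 1) * psi N.
  rewrite /psi 2!mulr_sumr -sumrB -big_split /=; apply: eq_bigr => l _.
  by rewrite /F -/(psi (N %/ l)); ring.
(* One N ln N of the main term comes from F(1) ln N, the other from the Mertens sum. *)
rewrite T1 S2 /F divn1 divr1 in T2.
move: m T2; set A := \sum_(_ <= _ < _) _; set B := \sum_(_ <= _ < _) _.
rewrite !ler_norml => /andP[m1 m2] /andP[t1 t2].
have e1 : N%:R * A - N%:R * ln N%:R <= 11 * N%:R.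
  by rewrite -mulrBr mulrC ler_pM2r.
have e2 : - (11 * N%:R) <= N%:R * A - N%:R * ln N%:R.
  by rewrite -mulrBr -mulNr mulrC ler_pM2l.
have e3 : `|(g + 1) * (psi N + ln N%:R)| <= 11 * `|g + 1| * N%:R.
  rewrite normrM mulrAC mulrC ler_wpM2r // ger0_norm; lra.
move: e3; rewrite ler_norml => /andP[e3 e4].
apply/andP; split; lra.
Qed.

End Selberg.

Lemma sum_nat_diff (V : zmodType) (F : nat -> V) (m n : nat) : (m <= n)%N ->
  \sum_(1 <= i < n.+1) F i - \sum_(1 <= i < m.+1) F i = \sum_(m.+1 <= i < n.+1) F i.
Proof.
by move=> mn; rewrite (@big_cat_nat _ _ _ m.+1 1 n.+1) //= addrAC subrr add0r.
Qed.

(** * Chebyshev's function at real arguments *)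

Section PsiReal.
Variable R : realType.
Local Notation mangoldt := (@mangoldt R).
Local Notation psi := (@psi R).
Implicit Types x y : R.

Definition Psi x : R := psi (Num.truncn x).

Definition logPsi x : R := \sum_(1 <= e < (Num.truncn x).+1) mangoldt e / e%:R.

Lemma truncn_div x (l : nat) : 0 <= x -> (0 < l)%N ->
  Num.truncn (x / l%:R) = (Num.truncn x %/ l)%N.
Proof.
move=> x0 l0; have l0' : 0 < l%:R :> R by rewrite ltr0n.
have /andP[t1 t2] := truncn_itv x0.
apply: truncn_def; rewrite ler_pdivlMr // ltr_pdivrMr // -!natrM; apply/andP; split.
  by apply: le_trans t1; rewrite ler_nat leq_divM.
by apply: (lt_le_trans t2); rewrite ler_nat ltn_ceil.
Qed.

Lemma Psi_ge0 x : 0 <= Psi x. Proof. exact: psi_ge0. Qed.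

Lemma Psi_mono x y : x <= y -> Psi x <= Psi y.
Proof. by move=> xy; apply/psi_mono/le_truncn. Qed.

Lemma Psi_le x : 0 <= x -> Psi x <= 10 * x.
Proof.
by move=> x0; apply: le_trans (psi_le _ _) _; rewrite ler_pM2l // truncn_le.
Qed.

Lemma Psi_lt1 x : x < 1 -> Psi x = 0.
Proof.
move=> x1; have /truncn0Pn h : ~~ (1 <= x) by rewrite -ltNge.
by rewrite /Psi h /psi big_geq.
Qed.

Lemma ln_truncn x : 1 <= x ->
  0 <= ln x - ln (Num.truncn x)%:R <= (Num.truncn x)%:R^-1.
Proof.
move=> x1; have /andP[t1 t2] := truncn_itv (le_trans ler01 x1).
have n0 : 0 < (Num.truncn x)%:R :> R by rewrite ltr0n truncn_gt0.
apply/andP; split; first by rewrite subr_ge0 ler_ln ?posrE //; lra.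
have /andP[_] := @ln_step R (Num.truncn x) (ltac:(by rewrite truncn_gt0)).
apply: le_trans; rewrite lerD2r ler_ln ?posrE ?ltr0n //; lra.
Qed.

Lemma logPsi_bounds x : 1 <= x -> `|logPsi x - ln x| <= 12.
Proof.
move=> x1; have n0 : (0 < Num.truncn x)%N by rewrite truncn_gt0.
have /andP[l1 l2] := ln_truncn x1.
have l3 : (Num.truncn x)%:R^-1 <= 1 :> R by rewrite invf_le1 ?ltr0n // ler1n.
have := mertens R n0; rewrite -/(logPsi x) !ler_norml => /andP[m1 m2].
by apply/andP; split; lra.
Qed.

Lemma Psi_logPsi x y : 0 < x -> x <= y -> (Psi y - Psi x) / y <= logPsi y - logPsi x.
Proof.
move=> x0 xy; have h := le_truncn xy.
rewrite /logPsi /Psi /psi !sum_nat_diff // mulr_suml; apply: ler_sum_nat => e /andP[xe ey].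
rewrite ler_wpM2l ?mangoldt_ge0 // lef_pV2 ?posrE.
- have : (e <= Num.truncn y)%N by [].
  by rewrite truncn_ge_nat //; lra.
- by lra.
- by rewrite ltr0n (leq_ltn_trans _ xe).
Qed.

Lemma logPsi_Psi x y : 0 < x -> x <= y -> logPsi y - logPsi x <= (Psi y - Psi x) / x.
Proof.
move=> x0 xy; have h := le_truncn xy.
rewrite /logPsi /Psi /psi !sum_nat_diff // mulr_suml; apply: ler_sum_nat => e /andP[xe ey].
rewrite ler_wpM2l ?mangoldt_ge0 // lef_pV2 ?posrE //.
- by apply: ltW; move: xe; rewrite truncn_lt_nat // ltW.
- by rewrite ltr0n (leq_ltn_trans _ xe).
Qed.

Definition convPsi x : R :=
  \sum_(1 <= l < (Num.truncn x).+1) mangoldt l * Psi (x / l%:R).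

Lemma convPsi_mono x y : 0 <= x -> x <= y -> convPsi x <= convPsi y.
Proof.
move=> x0 xy; have h := le_truncn xy.
rewrite /convPsi [leRHS](@big_cat_nat _ _ _ (Num.truncn x).+1) //=.
rewrite -[leLHS]addr0; apply: lerD.
  apply: ler_sum_nat => l /andP[l0 _]; rewrite ler_wpM2l ?mangoldt_ge0 //.
  by apply: Psi_mono; rewrite ler_pM2r // invr_gt0 ltr0n.
by apply: sumr_ge0 => n _; rewrite mulr_ge0 ?mangoldt_ge0 ?Psi_ge0.
Qed.

Lemma selberg_real : exists2 B : R, 0 <= B & forall x, 1 <= x ->
  `|Psi x * ln x + convPsi x - 2 * x * ln x| <= B * x.
Proof.
have [B HB] := selberg R.
exists (`|B| + 14); first by have := normr_ge0 B; lra.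
move=> x x1; have x0 : 0 <= x by lra.
have /andP[t1 t2] := truncn_itv x0.
have n0 : (0 < Num.truncn x)%N by rewrite truncn_gt0.
have n0' : 0 < (Num.truncn x)%:R :> R by rewrite ltr0n.
have := HB _ n0.
have -> : convPsi x = \sum_(1 <= l < (Num.truncn x).+1) mangoldt l * psi (Num.truncn x %/ l).
  by apply: eq_big_nat => l /andP[l0 _]; rewrite /Psi truncn_div.
have /andP[l1 l2] := ln_truncn x1.
have p0 := psi_ge0 R (Num.truncn x); have p1 := psi_le R (Num.truncn x).
have lx : ln x <= x by apply/ltW/ln_sublinear; lra.
have lx0 : 0 <= ln x by rewrite ln_ge0.
rewrite -natr1 in t2; rewrite /Psi.
move: n0' t1 t2 l1 l2 p0 p1; move: (psi _) (Num.truncn x)%:R (\sum_(_ <= _ < _) _) => P n S.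
move=> n0' t1 t2 l1 l2 p0 p1 h.
have e1 : n * (ln x - ln n) <= 1 by rewrite -ler_pdivlMl ?mulr1.
have e1' : 0 <= n * (ln x - ln n) by rewrite mulr_ge0 // ltW.
have e2 : P * (ln x - ln n) <= 10 by apply: le_trans (ler_wpM2r l1 p1) _; lra.
have e2' : 0 <= P * (ln x - ln n) by rewrite mulr_ge0.
have e3 : (x - n) * ln x <= x by apply: le_trans lx; rewrite ler_piMl //; lra.
have e3' : 0 <= (x - n) * ln x by rewrite mulr_ge0 //; lra.
have b1 : B * n <= `|B| * x.
  apply: (@le_trans _ _ (`|B| * n)); first by rewrite ler_pM2r // ler_norm.
  by rewrite ler_wpM2l.
move: h; rewrite !ler_norml => /andP[h1 h2]; apply/andP; split; lra.
Qed.

(** No interval of bounded ratio has density much above 2: subtract Selberg's formula at x from the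
    one at y and drop the increment of the monotone [convPsi]. After division by ln x the errors are
    O(x / ln x), which d x absorbs for large x. *)
Lemma Psi_upper (r d : R) : 1 <= r -> 0 < d ->
  exists2 T, 1 <= T & forall x y, T <= x -> x <= y -> y <= r * x ->
    Psi y - Psi x <= 2 * (y - x) + d * x.
Proof.
move=> r1 d0; have [B B0 HB] := selberg_real.
have [K KE] : exists K, K = 2 * r * r + B * (1 + r) by exists (2 * r * r + B * (1 + r)).
have K0 : 0 <= K by rewrite KE addr_ge0 // !mulr_ge0 //; lra.
have Kd : 0 <= K / d by rewrite divr_ge0 // ltW.
exists (expR (K / d + 1)); first by rewrite -[leLHS]expR0 ler_expR; lra.
move=> x y Tx xy yr.
have x1 : 1 < x.
  apply: lt_le_trans Tx; by rewrite -[ltLHS]expR0 ltr_expR; lra.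
have x0 : 0 < x by exact: lt_trans ltr01 x1.
have lnx : K / d + 1 <= ln x by rewrite -ler_expR lnK.
have lnx0 : 0 < ln x by rewrite ln_gt0.
have y0 : 0 < y by lra.
have := HB x (ltW x1); have := HB y (le_trans (ltW x1) xy).
have cm := convPsi_mono (ltW x0) xy.
have pm := Psi_mono xy; have p0 := Psi_ge0 y.
have lyx : ln y - ln x <= r.
  rewrite -ln_div ?posrE //; apply: le_trans (_ : y / x <= _).
    by apply/ltW/ln_sublinear; rewrite divr_gt0.
  by rewrite ler_pdivrMr.
have lyx0 : 0 <= ln y - ln x by rewrite subr_ge0 ler_ln.
rewrite !ler_norml => /andP[_ a1] /andP[b1 _].
rewrite -(ler_pM2r lnx0).
have e1 : 0 <= Psi y * (ln y - ln x) by rewrite mulr_ge0.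
have e2 : y * (ln y - ln x) <= r * x * r by apply: ler_pM => //; lra.
have e3 : B * y <= B * (r * x) by rewrite ler_wpM2l.
have e4 : K * x <= d * x * ln x.
  rewrite mulrAC ler_pM2r // -ler_pdivrMl // mulrC; lra.
rewrite KE in e4; lra.
Qed.

End PsiReal.

(** * Primes in short intervals *)

Lemma bernoulli_le (R : realDomainType) (w : R) (n : nat) : 1 <= w ->
  n%:R * (w - 1) <= w ^+ n.
Proof.
move=> w1; elim: n => [|n IH]; first by rewrite mul0r expr0.
have wn : 1 <= w ^+ n by rewrite exprn_ege1.
have : 0 <= (w ^+ n - 1) * (w - 1) by rewrite mulr_ge0 //; lra.
by rewrite exprSr -natr1; lra.
Qed.

Lemma expr_unbounded (R : realType) (w x : R) : 1 < w ->
  exists n0 : nat, forall n, (n0 <= n)%N -> x <= w ^+ n.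
Proof.
move=> w1; exists (Num.bound (x / (w - 1))) => n nb.
apply: le_trans (bernoulli_le n (ltW w1)).
rewrite -ler_pdivrMr ?subr_gt0 //; apply/ltW/(le_lt_trans (ler_norm _)).
apply: (lt_le_trans (archi_boundP (normr_ge0 _))); rewrite ler_nat.
by apply: leq_trans nb; rewrite /Num.bound normr_id.
Qed.

(** Split w^n into two powers of sqrt w: Bernoulli makes one of them grow linearly, and the other
    absorbs the constant. *)
Lemma expr_linear_le (R : realType) (w x : R) : 0 <= x -> 1 < w ->
  exists n0 : nat, forall n, (n0 <= n)%N -> x * n%:R <= w ^+ n.
Proof.
move=> x0 w1; have w0 : 0 <= w by lra.
have v1 : 1 < Num.sqrt w by rewrite -sqrtr1 ltr_sqrt //; lra.
have [n0 Hn0] := expr_unbounded (x / (Num.sqrt w - 1)) v1.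
exists n0 => n /Hn0; rewrite ler_pdivrMr ?subr_gt0 // => h.
have b := bernoulli_le n (ltW v1).
have -> : w ^+ n = Num.sqrt w ^+ n * Num.sqrt w ^+ n by rewrite -exprMn -expr2 sqr_sqrtr.
apply: (@le_trans _ _ (Num.sqrt w ^+ n * (Num.sqrt w - 1) * n%:R)); first by rewrite ler_wpM2r.
by rewrite -mulrA ler_wpM2l ?exprn_ge0 ?sqrtr_ge0 // mulrC.
Qed.

(** * The covering argument of Erdos *)

Section Erdos.
Variable R : realType.
Local Notation mangoldt := (@mangoldt R).
Local Notation Psi := (@Psi R).
Local Notation logPsi := (@logPsi R).
Local Notation convPsi := (@convPsi R).
Implicit Types x y c d k t w N T Q Y : R.

(** If J = ]N, cN] has little mass, the difference of Selberg's formulas at cN and N must come from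
    the masses of the intervals J/l. Their Lambda-weighted total is thus close to the value given by
    density 2, so the total deficit is small. Only l <= N/T is kept, because [Psi_upper] applies to
    N/l >= T. *)
Lemma deficit_sum c d T : 1 <= c -> 0 < d -> 1 <= T ->
  exists B : R, forall N eta, T <= N -> Psi (c * N) - Psi N <= eta * N ->
  \sum_(1 <= l < (Num.truncn (N / T)).+1)
    mangoldt l * ((2 * (c - 1) + d) * (N / l%:R) - (Psi (c * N / l%:R) - Psi (N / l%:R)))
  <= (d + eta) * (N * ln N) + B * N.
Proof.
move=> c1 d0 T1; have [B B0 HB] := selberg_real R.
(* In order: Mertens' error up to N/T, Selberg's errors at N and cN, the change from ln(cN) to ln N,
   and the terms with l > N/T, whose Mertens mass is at most ln c + ln T + 24. *)
exists (12 * (2 * (c - 1) + d) + B * (c + 1) + 10 * c * ln c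
  + 10 * c * (ln c + ln T + 24)).
move=> N eta TN hN.
have N1 : 1 <= N by lra.
have N0 : 0 < N by lra.
have c0 : 0 < c by lra.
have T0 : 0 < T by lra.
have Nc : N <= c * N by rewrite ler_peMl // ltW.
have cN1 : 1 <= c * N by lra.
have NT1 : 1 <= N / T by rewrite ler_pdivlMr ?mul1r.
have NTN : N / T <= N by rewrite ler_pdivrMr // ler_peMr // ltW.
have lnN0 : 0 <= ln N by rewrite ln_ge0.
have lnc0 : 0 <= ln c by rewrite ln_ge0.
have lncN : ln (c * N) = ln c + ln N by rewrite lnM ?posrE.
have lnNT : ln (N / T) = ln N - ln T by rewrite ln_div ?posrE.
have lnT0 : 0 <= ln T by rewrite ln_ge0.
set M := Num.truncn (N / T).
pose a (l : nat) := Psi (c * N / l%:R) - Psi (N / l%:R).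
have MN : (M <= Num.truncn (c * N))%N by apply: le_truncn; lra.
have conv : convPsi (c * N) - convPsi N =
    \sum_(1 <= l < M.+1) mangoldt l * a l +
    \sum_(M.+1 <= l < (Num.truncn (c * N)).+1) mangoldt l * a l.
  have -> : convPsi N = \sum_(1 <= l < (Num.truncn (c * N)).+1) mangoldt l * Psi (N / l%:R).
    have tN := le_truncn Nc.
    rewrite [RHS](@big_cat_nat _ _ _ (Num.truncn N).+1) //= [X in _ + X]big_nat_cond.
    rewrite [X in _ + X]big1 ?addr0 // => l /andP[/andP[Nl _] _].
    have l0 : 0 < l%:R :> R by rewrite ltr0n (leq_ltn_trans _ Nl).
    rewrite Psi_lt1 ?mulr0 // ltr_pdivrMr // mul1r.
    by move: Nl; rewrite truncn_lt_nat // ltW.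
  rewrite /convPsi -sumrB -big_cat_nat //=; apply: eq_bigr => l _.
  by rewrite /a mulrBr.
have tail : \sum_(M.+1 <= l < (Num.truncn (c * N)).+1) mangoldt l * a l <=
    10 * c * N * (ln c + ln T + 24).
  apply: (@le_trans _ _ (10 * (c * N) * (logPsi (c * N) - logPsi (N / T)))).
    rewrite /logPsi sum_nat_diff // mulr_sumr; apply: ler_sum_nat => l /andP[Ml _].
    have l0 : 0 < l%:R :> R by rewrite ltr0n (leq_ltn_trans _ Ml).
    rewrite mulrCA ler_wpM2l ?mangoldt_ge0 // -mulrA.
    apply: (@le_trans _ _ (Psi (c * N / l%:R))); first by rewrite gerBl Psi_ge0.
    by apply: Psi_le; rewrite divr_ge0 // ltW // mulr_gt0.
  have -> : 10 * c * N * (ln c + ln T + 24) = 10 * (c * N) * (ln c + ln T + 24) by ring.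
  rewrite ler_pM2l ?mulr_gt0 //.
  have := logPsi_bounds cN1; have := logPsi_bounds NT1.
  by rewrite !ler_norml => /andP[u1 u2] /andP[u3 u4]; lra.
have head : \sum_(1 <= l < M.+1)
    mangoldt l * ((2 * (c - 1) + d) * (N / l%:R) - (Psi (c * N / l%:R) - Psi (N / l%:R))) =
    (2 * (c - 1) + d) * N * logPsi (N / T) - \sum_(1 <= l < M.+1) mangoldt l * a l.
  rewrite /logPsi mulr_sumr -sumrB; apply: eq_bigr => l _.
  by rewrite /a; ring.
rewrite head.
have hl : (2 * (c - 1) + d) * N * logPsi (N / T) <= (2 * (c - 1) + d) * N * (ln N + 12).
  rewrite ler_wpM2l //; first by rewrite mulr_ge0 //; lra.
  by have := logPsi_bounds NT1; rewrite ler_norml => /andP[_]; lra.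
have := HB _ N1; have := HB _ cN1.
rewrite !ler_norml => /andP[s1 _] /andP[_ s2].
have e1 : (Psi (c * N) - Psi N) * ln N <= eta * N * ln N by rewrite ler_wpM2r.
have e2 : Psi (c * N) * ln c <= 10 * (c * N) * ln c.
  by rewrite ler_wpM2r // Psi_le //; lra.
have e3 : 0 <= c * N * ln c by rewrite mulr_ge0 //; lra.
rewrite lncN in s1.
lra.
Qed.

(** The interval ]N/l, cN/l] has almost the largest mass that [Psi_upper] allows, k being the
    tolerated loss. *)
Definition full c k N (l : nat) : bool :=
  (2 * (c - 1) - k) * (N / l%:R) <= Psi (c * N / l%:R) - Psi (N / l%:R).

(** Markov's inequality for [deficit_sum]: by [Psi_upper] no term is negative, and a term that is
    not full is at least k N Lambda(l)/l. *)
Lemma not_full_weight c d k T : 1 <= c -> 0 < d -> 0 < k -> 1 <= T ->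
  (forall x y, T <= x -> x <= y -> y <= c * x -> Psi y - Psi x <= 2 * (y - x) + d * x) ->
  exists B : R, forall N eta, T <= N -> Psi (c * N) - Psi N <= eta * N ->
  \sum_(1 <= l < (Num.truncn (N / T)).+1 | ~~ full c k N l) mangoldt l / l%:R
  <= ((d + eta) * ln N + B) / k.
Proof.
move=> c1 d0 k0 T1 U; have [B HB] := deficit_sum c1 d0 T1.
exists B => N eta TN hN; have h0 := HB N eta TN hN.
have N0 : 0 < N by lra.
have T0 : 0 < T by lra.
rewrite ler_pdivlMr // -(ler_pM2r N0).
have -> : ((d + eta) * ln N + B) * N = (d + eta) * (N * ln N) + B * N by ring.
apply: le_trans h0.
rewrite -mulrA mulr_suml big_mkcond /=.
apply: ler_sum_nat => l /andP[l0 lM].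
have l0' : 0 < l%:R :> R by rewrite ltr0n.
have NlT : T <= N / l%:R.
  have : (l <= Num.truncn (N / T))%N by [].
  have NT0 : 0 <= N / T by rewrite divr_ge0 // ltW.
  rewrite truncn_ge_nat // ler_pdivlMr // => h.
  by rewrite ler_pdivlMr // mulrC.
have Nl0 : 0 < N / l%:R by lra.
have h : Psi (c * N / l%:R) - Psi (N / l%:R) <= (2 * (c - 1) + d) * (N / l%:R).
  have := U (N / l%:R) (c * N / l%:R) NlT.
  rewrite -mulrA => /(_ _ _); rewrite ler_peMl ?(ltW Nl0) // => /(_ isT (lexx _)).
  by lra.
case: ifP => [|_]; last by rewrite mulr_ge0 ?mangoldt_ge0 // subr_ge0.
rewrite /full -ltNge => b.
have -> : mangoldt l / l%:R * (k * N) = mangoldt l * (k * (N / l%:R)) by ring.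
rewrite ler_wpM2l ?mangoldt_ge0 //.
have : 0 <= d * (N / l%:R) by rewrite mulr_ge0 // ltW.
lra.
Qed.

(** Pigeonhole over the m disjoint blocks ]Q^i, Q^(i+1)]. *)
Lemma sparse_block (f : nat -> R) Q X (i0 m : nat) : (forall l, 0 <= f l) ->
  1 <= Q -> Q ^+ (i0 + m) <= X -> (0 < m)%N ->
  exists i, (i0 <= i < i0 + m)%N /\
    m%:R * \sum_((Num.truncn (Q ^+ i)).+1 <= l < (Num.truncn (Q ^+ i.+1)).+1) f l
    <= \sum_(1 <= l < (Num.truncn X).+1) f l.
Proof.
move=> f0 Q1 QX m0.
pose G x := \sum_(1 <= l < (Num.truncn x).+1) f l.
have Gm x y : x <= y -> G x <= G y.
  move=> /le_truncn h; rewrite -subr_ge0 sum_nat_diff //.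
  by apply: sumr_ge0.
apply: contrapT => H.
have H' i : (i0 <= i < i0 + m)%N -> G X < m%:R * (G (Q ^+ i.+1) - G (Q ^+ i)).
  move=> ii; rewrite ltNge; apply/negP => h; apply: H; exists i; split => //.
  move: h; rewrite /G sum_nat_diff //; apply: le_truncn.
  by rewrite exprS ler_peMl // exprn_ge0 //; lra.
have : \sum_(i0 <= i < i0 + m) G X < \sum_(i0 <= i < i0 + m) m%:R * (G (Q ^+ i.+1) - G (Q ^+ i)).
  rewrite big_nat [ltRHS]big_nat; apply: ltr_sum => //.
  apply/hasP; exists i0; first by rewrite mem_index_iota leqnn /= -{1}[i0]addn0 ltn_add2l.
  by rewrite leqnn /= -{1}[i0]addn0 ltn_add2l.
rewrite -mulr_sumr telescope_sumr ?leq_addr // sumr_const_nat addKn -[G X *+ m]mulr_natl.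
rewrite ltr_pM2l ?ltr0n //; apply/negP; rewrite -leNgt.
have : G (Q ^+ (i0 + m)) <= G X by exact: Gm.
have : 0 <= G (Q ^+ i0) by apply: sumr_ge0.
lra.
Qed.

(** * Chaining intervals of density almost 2 *)

Section Chain.
Variables N Y Q w c t d k T sg a : R.
Hypotheses (N0 : 0 < N) (Y0 : 0 < Y) (Q0 : 0 < Q) (w1 : 1 < w) (c1 : 1 <= c) (t1 : 1 <= t)
  (wE : w = c * (t * t)) (d0 : 0 <= d) (k0 : 0 <= k) (T1 : 1 <= T).
Hypothesis U : forall x y, T <= x -> x <= y -> y <= c * x ->
  Psi y - Psi x <= 2 * (y - x) + d * x.
Hypothesis QT : Q * Y <= N / T.
Hypothesis window : forall y, Y <= y -> w * y <= Q * Y ->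
  exists l : nat, [/\ y < l%:R, l%:R <= w * y & full c k N l].
Hypothesis aE : a = 2 * (1 - (t * t)^-1) + d + k.
Hypothesis sgE : 2 * a <= sg * (1 - w^-1).
Let D x := 2 * x - Psi x.

Lemma inv_sqr_le1 : (t * t)^-1 <= 1.
Proof using t1.
have t0 : 0 < t by exact: lt_le_trans ltr01 t1.
by rewrite invf_le1 ?mulr_gt0 // mulr_ege1.
Qed.

(** [D] measures the deficit against density 2. With u = N/l and z = c u, the interval ]u, z] loses
    at most k u. If z < x, the gap ]z, x] is short, as x <= t^2 z, and costs at most 2(x - z); if z
    exceeds x, [Psi_upper] bounds the mass of the excess. *)
Lemma full_step x (l : nat) : 0 < x -> full c k N l -> (0 < l)%N ->
  N / l%:R < x -> l%:R * x <= w * N -> T <= N / l%:R ->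
  D x <= D (N / l%:R) + a * x.
Proof using aE N0 Y0 w1 c1 t1 wE d0 k0 T1 U.
move: (N0) (w1) (c1) (t1) (d0) (k0) (T1) => ? ? ? ? ? ? ?.
move=> x0 fl l0 lx lw lT.
have l0' : 0 < l%:R :> R by rewrite ltr0n.
move: fl; rewrite /full -mulrA; have [u uE] : exists u, u = N / l%:R by exists (N / l%:R).
have [z zE] : exists z, z = c * u by exists (c * u).
rewrite -uE in lx lT *; rewrite -zE => fl.
have u0 : 0 < u by rewrite uE divr_gt0.
have tt0 : 0 < t * t by rewrite mulr_gt0 ?(lt_le_trans ltr01 t1).
have zx : x * (t * t)^-1 <= z.
  rewrite ler_pdivrMr // zE uE.
  have -> : c * (N / l%:R) * (t * t) = w * N / l%:R by rewrite wE; ring.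
  by rewrite ler_pdivlMr // mulrC.
have ku : k * u <= k * x by rewrite ler_wpM2l // ltW.
have dx0 : 0 <= d * x by rewrite mulr_ge0 // ltW.
have ax : a * x = 2 * x - 2 * (x * (t * t)^-1) + d * x + k * x by rewrite aE; ring.
rewrite ax /D.
have [zx'|xz] := leP z x.
  by have := Psi_mono zx'; move: (Psi z) (Psi x) (Psi u) fl => *; lra.
have tt1 := inv_sqr_le1.
have xt : x * (t * t)^-1 <= x by rewrite ler_piMr // ltW.
have zcx : z <= c * x by rewrite zE ler_wpM2l //; lra.
have := U (ltW (le_lt_trans lT lx)) (ltW xz) zcx.
by move: (Psi z) (Psi x) (Psi u) fl => *; lra.
Qed.

(** One step may shrink x by an arbitrarily small amount. Taking l as the largest full integer in
    ]N/x, wN/x] forces the next one, found in ]l, wl], beyond wN/x, so two steps shrink x by the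
    factor w. *)
Lemma full_two_steps x : w * w * N / (Q * Y) <= x -> x <= N / Y ->
  exists y, [/\ 0 <= y, y <= x / w & D x <= D y + 2 * a * x].
Proof using aE N0 Y0 Q0 w1 c1 t1 wE d0 k0 T1 U QT window.
move: (N0) (w1) (c1) (t1) (d0) (k0) (T1) => ? ? ? ? ? ? ?.
move=> x1 x2.
have w0 : 0 < w by lra.
have T0 : 0 < T by lra.
have QY0 : 0 < Q * Y by rewrite mulr_gt0.
have x0 : 0 < x by apply: lt_le_trans x1; rewrite divr_gt0 ?mulr_gt0.
have [y yE] : exists y, y = N / x by exists (N / x).
have y0 : 0 < y by rewrite yE divr_gt0.
have Yy : Y <= y by rewrite yE ler_pdivlMr // mulrC -ler_pdivlMr.
have wwy : w * w * y <= Q * Y.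
  by rewrite yE mulrA ler_pdivrMr // [_ * x]mulrC -ler_pdivrMr.
have xE : x = N / y by rewrite yE invf_div mulrC divfK // gt_eqF.
have wy : w * y <= Q * Y.
  by apply: le_trans wwy; rewrite ler_pM2r // ler_peMl // ltW.
pose P (l : nat) := [&& y < l%:R, l%:R <= w * y & full c k N l].
have exP : exists l, P l.
  by have [l [l1 l2 l3]] := window Yy wy; exists l; apply/and3P.
have ubP (l : nat) : P l -> (l <= Num.truncn (w * y))%N.
  by move=> /and3P[_ h _]; rewrite truncn_ge_nat // mulr_ge0 // ltW.
case: (ex_maxnP exP ubP) => l /and3P[l1 l2 l3] lmax.
have l0 : 0 < l%:R :> R by lra.
have lN0 : (0 < l)%N by rewrite -(ltr0n R).
have wl : w * l%:R <= Q * Y.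
  by apply: le_trans wwy; rewrite -mulrA ler_pM2l.
have [l' [l'1 l'2 l'3]] := window (ltW (le_lt_trans Yy l1)) wl.
have l'0 : 0 < l'%:R :> R by lra.
have l'N0 : (0 < l')%N by rewrite -(ltr0n R).
have wyl' : w * y < l'%:R.
  rewrite ltNge; apply/negP => h.
  have /lmax : P l' by apply/and3P; split => //; lra.
  by rewrite -(ler_nat R); lra.
have big (j : nat) : 0 < j%:R :> R -> j%:R <= Q * Y -> T <= N / j%:R.
  move=> j0 jQ; have : j%:R <= N / T := le_trans jQ QT.
  by rewrite !ler_pdivlMr // mulrC.
have u0 : 0 < N / l%:R by rewrite divr_gt0.
have ux : N / l%:R < x by rewrite xE ltr_pM2l // ltf_pV2 ?posrE.
have a0 : 0 <= a by have := inv_sqr_le1; rewrite aE; lra.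
exists (N / l'%:R); split; first exact/ltW/divr_gt0.
  rewrite xE -mulrA -invfM [y * w]mulrC ler_pM2l // lef_pV2 ?posrE ?mulr_gt0 //.
  exact: ltW.
have yx : y * x = N by rewrite yE divfK // gt_eqF.
have ul : l%:R * (N / l%:R) = N by rewrite mulrC divfK // gt_eqF.
have s1 : D x <= D (N / l%:R) + a * x.
  apply: full_step => //; first by rewrite -[in leRHS]yx mulrA ler_pM2r.
  by apply: big => //; lra.
have s2 : D (N / l%:R) <= D (N / l'%:R) + a * (N / l%:R).
  apply: full_step => //.
  - by rewrite ltr_pM2l // ltf_pV2 ?posrE.
  - by rewrite -[in leRHS]ul [leRHS]mulrA ler_pM2r.
  - by apply: big => //; lra.
have : a * (N / l%:R) <= a * x by rewrite ler_wpM2l // ltW.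
lra.
Qed.

(** The errors 2 a x of the successive double steps form a geometric series of ratio 1/w, with sum
    at most sg x. The descent stops below w^2 N/(QY), where the bound holds because [Psi] is
    nonnegative. *)
Lemma full_chain x : 0 <= x -> x <= N / Y ->
  (2 - sg) * x - 2 * (w * w * N / (Q * Y)) <= Psi x.
Proof using aE N0 Y0 Q0 w1 c1 t1 wE d0 k0 T1 U QT window sgE.
move: (N0) (w1) (c1) (t1) (d0) (k0) (T1) => ? ? ? ? ? ? ?.
have [X XE] : exists X, X = w * w * N / (Q * Y) by exists (w * w * N / (Q * Y)).
rewrite -XE.
have w0 : 0 < w by lra.
have X0 : 0 < X by rewrite XE divr_gt0 // !mulr_gt0.
have w_1 : w^-1 < 1 by rewrite invf_lt1.
have a0 : 0 <= a by have := inv_sqr_le1; rewrite aE; lra.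
have sg0 : 0 <= sg.
  move: (sgE) => ?.
  have : 0 <= sg * (1 - w^-1) by lra.
  by rewrite pmulr_lge0 //; lra.
have [n xn] : exists n : nat, x <= w ^+ n * X.
  have [n /(_ n (leqnn n)) hn] := expr_unbounded (x / X) w1.
  by exists n; rewrite -ler_pdivrMr.
elim: n x xn => [|n IH] x xn x0 xY.
  rewrite expr0 mul1r in xn; have : 0 <= sg * x by rewrite mulr_ge0.
  by have := Psi_ge0 x; lra.
have [xX|Xx] := leP x X.
  have : 0 <= sg * x by rewrite mulr_ge0.
  by have := Psi_ge0 x; lra.
move: (sgE) => sgE'.
have [y [y0 yx Dxy]] := full_two_steps (eq_rect _ (fun z => z <= x) (ltW Xx) _ XE) xY.
have yx' : y <= x by apply: le_trans yx _; rewrite ler_pdivrMr // ler_peMr // ltW.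
have yn : y <= w ^+ n * X.
  by apply: (le_trans yx); rewrite ler_pdivrMr // mulrAC -exprSr.
have := IH y yn y0 (le_trans yx' xY).
have e1 : sg * y <= sg * (x * w^-1) by rewrite ler_wpM2l.
have e2 : 2 * a * x <= sg * (1 - w^-1) * x by rewrite ler_wpM2r.
by move: Dxy; rewrite /D; lra.
Qed.
End Chain.
End Erdos.

Section ShortIntervals.
Variable R : realType.
Local Notation mangoldt := (@mangoldt R).
Local Notation psi := (@psi R).
Local Notation Psi := (@Psi R).
Local Notation logPsi := (@logPsi R).
Implicit Types x y c d k t w N T Q Y : R.

Lemma abel_logPsi (a b : nat) : (a <= b)%N ->
  \sum_(a.+1 <= e < b.+1) mangoldt e / e%:R =
  psi b / b.+1%:R - psi a / a.+1%:R + \sum_(a.+1 <= e < b.+1) psi e / (e%:R * e.+1%:R).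
Proof.
elim: b => [|b IH]; rewrite leq_eqVlt => /predU1P[->|].
- by rewrite !big_geq // subrr addr0.
- by [].
- by rewrite !big_geq // subrr addr0.
rewrite ltnS => ab; rewrite big_nat_recr //= [in RHS]big_nat_recr //= IH //.
have -> : psi b.+1 = psi b + mangoldt b.+1 by rewrite /psi big_nat_recr.
move: (\sum_(_ <= _ < _) _) => S.
rewrite -[b.+2%:R]natr1; have : 0 < b.+1%:R :> R by rewrite ltr0n.
have : 0 < a.+1%:R :> R by rewrite ltr0n.
move: (b.+1%:R) (a.+1%:R) (psi b) (psi a) (mangoldt _) => u v P P' L u0 v0.
by field; rewrite !gt_eqF //; lra.
Qed.

(** By partial summation such a bound makes the Mertens sum grow at least like (7/4) ln(X1/X0),
    while its true growth is ln(X1/X0). The excess, at least (3/4) 60 = 45, beats the errors: 24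
    from Mertens, 10 and 2 from boundary terms, and 21/4 from shifting a logarithm. *)
Lemma no_double_density (X0 X1 : R) : 1 <= X0 -> X0 * expR 60 <= X1 ->
  ~ (forall x, 0 <= x -> x <= X1 -> 7 / 4 * x - 2 * X0 <= Psi x).
Proof.
move=> X01 X1X0 H.
have X00 : 0 < X0 by lra.
have e1 : 1 <= expR (60 : R) by rewrite -expR0 ler_expR.
have X0X1 : X0 <= X1 by apply: le_trans X1X0; rewrite ler_peMr // ltW.
have X11 : 1 <= X1 by lra.
have D60 : ln X0 + 60 <= ln X1.
  by rewrite -[X in _ + X]expRK -lnM ?posrE ?expR_gt0 // ler_ln ?posrE ?mulr_gt0 ?expR_gt0 //; lra.
have := logPsi_bounds X11; have := logPsi_bounds X01.
rewrite !ler_norml => /andP[u1 u2] /andP[u3 u4].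
have ab := le_truncn X0X1.
have /andP[a1 a2] := truncn_itv (ltW X00).
have /andP[b1 b2] := truncn_itv (le_trans ler01 X11).
have dif : logPsi X1 - logPsi X0 = \sum_((Num.truncn X0).+1 <= e < (Num.truncn X1).+1) mangoldt e / e%:R.
  by rewrite /logPsi sum_nat_diff.
move: dif; rewrite abel_logPsi //; move: ab a1 a2 b1 b2.
move: (Num.truncn X0) (Num.truncn X1) => a b ab a1 a2 b1 b2 dif.
have as0 : 0 < a.+1%:R :> R by rewrite ltr0n.
have s1 : \sum_(a.+1 <= e < b.+1) (7 / 4 * e.+1%:R^-1 - 2 * X0 * (e%:R^-1 - e.+1%:R^-1)) <=
   \sum_(a.+1 <= e < b.+1) psi e / (e%:R * e.+1%:R).
  apply: ler_sum_nat => e /andP[ae eb].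
  have e0 : 0 < e%:R :> R by rewrite ltr0n (leq_ltn_trans _ ae).
  have eX : e%:R <= X1 by apply: le_trans b1; rewrite ler_nat.
  have := H e%:R (ltW e0) eX; rewrite /Psi natrK => He.
  have -> : 7 / 4 * e.+1%:R^-1 - 2 * X0 * (e%:R^-1 - e.+1%:R^-1) =
     (7 / 4 * e%:R - 2 * X0) / (e%:R * e.+1%:R).
    by rewrite -natr1; field; rewrite !gt_eqF //; lra.
  by rewrite ler_pM2r // invr_gt0 mulr_gt0 // ltr0n.
have s2 : ln (b.+2%:R : R) - ln (a.+2%:R : R) <= \sum_(a.+1 <= e < b.+1) e.+1%:R^-1.
  rewrite -(@telescope_sumr _ a.+1 b.+1 (fun i => ln (i.+1%:R : R))) //.
  by apply: ler_sum_nat => e _; have /andP[] := @ln_step R e.+1 isT.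
have s3 : \sum_(a.+1 <= e < b.+1) (e%:R^-1 - e.+1%:R^-1 : R) = a.+1%:R^-1 - b.+1%:R^-1.
  rewrite -[LHS]opprK -sumrN -[RHS]opprK opprB.
  rewrite -(@telescope_sumr _ a.+1 b.+1 (fun i => i%:R^-1 : R)) //.
  by congr (- _); apply: eq_bigr => e _; rewrite opprB.
rewrite sumrB -!mulr_sumr s3 in s1.
have bs0 : 0 < b.+1%:R :> R by rewrite ltr0n.
have t1 : X0 * (a.+1%:R^-1 - b.+1%:R^-1) <= 1.
  apply: (@le_trans _ _ (X0 / a.+1%:R)).
    by rewrite ler_pM2l // gerBl invr_ge0 ltW.
  by rewrite ler_pdivrMr // mul1r ltW.
have t2 : psi a / a.+1%:R <= 10.
  rewrite ler_pdivrMr //; apply: le_trans (psi_le _ _) _.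
  by rewrite ler_pM2l // ler_nat.
have t3 : 0 <= psi b / b.+1%:R by rewrite divr_ge0 ?psi_ge0 // ltW.
have t4 : ln X1 <= ln (b.+2%:R : R).
  rewrite ler_ln ?posrE ?ltr0n //; last by lra.
  by apply/ltW/(lt_trans b2); rewrite ltr_nat.
have t5 : ln (a.+2%:R : R) <= ln X0 + 3.
  have ln3 : ln (3 : R) < 3 by exact: ln_sublinear.
  apply: (@le_trans _ _ (ln (X0 * 3))); last by rewrite lnM ?posrE //; lra.
  rewrite ler_ln ?posrE ?ltr0n ?mulr_gt0 // -natr1 -natr1; lra.
move: s1 s2 t1 t2 t3 t4 t5 dif.
move: (\sum_(_ <= _ < _) psi _ / _) (\sum_(_ <= _ < _) _) (psi b / _) (psi a / _).
move: (a.+1%:R^-1) (b.+1%:R^-1) (ln b.+2%:R) (ln a.+2%:R) => *.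
lra.
Qed.

(** Otherwise the whole mass of Lambda(l)/l on ]y, wy], which exceeds eta1/w, would belong to
    integers that are not full. *)
Lemma full_window w c k N Y Q y eta1 : 0 < y -> 1 < w ->
  Y <= y -> w * y <= Q * Y ->
  eta1 * y < Psi (w * y) - Psi y ->
  \sum_((Num.truncn Y).+1 <= l < (Num.truncn (Q * Y)).+1)
     (if full c k N l then 0 else mangoldt l / l%:R) <= eta1 / w ->
  exists l : nat, [/\ y < l%:R, l%:R <= w * y & full c k N l].
Proof.
move=> y0 w1 Yy wy hm hb; apply: contrapT => H.
have w0 : 0 < w by lra.
have ywy : y <= w * y by rewrite ler_peMl // ltW.
have wy0 : 0 < w * y by rewrite mulr_gt0.
have := Psi_logPsi y0 ywy; rewrite [leRHS]sum_nat_diff ?le_truncn // => h1.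
have : eta1 / w < (Psi (w * y) - Psi y) / (w * y).
  by rewrite ltr_pdivlMr // mulrA divfK ?gt_eqF.
move=> /lt_le_trans /(_ h1); apply/negP; rewrite -leNgt; apply: le_trans hb.
have t1 := le_truncn Yy; have t2 := le_truncn ywy; have t3 := le_truncn wy.
have f0 l : 0 <= (if full c k N l then 0 else mangoldt l / l%:R : R).
  by case: ifP => // _; rewrite divr_ge0 ?mangoldt_ge0.
rewrite [leRHS](@big_cat_nat _ _ _ (Num.truncn y).+1) //=; last first.
  by rewrite ltnS (leq_trans t2).
rewrite [X in _ <= _ + X](@big_cat_nat _ _ _ (Num.truncn (w * y)).+1) //=.
rewrite -[leLHS]add0r; apply: lerD; first by apply: sumr_ge0.
rewrite -[leLHS]addr0; apply: lerD; last by apply: sumr_ge0.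
apply: ler_sum_nat => l /andP[yl lwy]; case: ifP => // fl.
exfalso; apply: H; exists l; split => //.
- by move: yl; rewrite truncn_lt_nat // ltW.
- by move: lwy; rewrite ltnS truncn_ge_nat // ltW.
Qed.

Definition dense_ratio (r : R) : Prop := exists2 eta, 0 < eta &
  exists y0, forall y, y0 <= y -> eta * y < Psi (r * y) - Psi y.

Lemma sparse_ratio (r eta y0 : R) : ~ dense_ratio r -> 0 < eta ->
  exists2 y, y0 <= y & Psi (r * y) - Psi y <= eta * y.
Proof.
move=> nd eta0; apply: contrapT => H; apply: nd; exists eta => //; exists y0 => y yy.
by rewrite ltNge; apply/negP => h; apply: H; exists y.
Qed.

(** Mertens gives ]y, ry] a logarithmic mass of at least ln r - 24, whereas a sparse interval can be
    chosen with mass at most 1. *)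
Lemma sparse_ratio_le (r : R) : 1 <= r -> ~ dense_ratio r -> r <= expR 25.
Proof.
move=> r1 /(@sparse_ratio r 1 1) /(_ ltr01)[y y1 hy].
have y0 : 0 < y by lra.
have yr : y <= r * y by rewrite ler_peMl // ltW.
have := logPsi_Psi y0 yr.
have : (Psi (r * y) - Psi y) / y <= 1 by rewrite ler_pdivrMr.
have := logPsi_bounds y1; have := logPsi_bounds (le_trans y1 yr).
rewrite lnM ?posrE //; last by lra.
rewrite !ler_norml => /andP[u1 u2] /andP[u3 u4] v1 v2.
by rewrite -[r]lnK ?posrE ?ler_expR; lra.
Qed.

(* Erdos: otherwise let [C > 1] be the supremum of the ratios [r] for which
   ]y, ry] carries arbitrarily small relative mass.  If [J = ]N, cN]], with [c]
   just below [C], is almost empty, then Selberg's formula forces J/l to have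
   density 2 for almost all l; as such l occur in every ]y, wy] with [w] just
   above [C], the sets J/l cover a long interval almost completely, against
   Mertens' estimate. *)
Lemma Psi_short_intervals (r : R) : 1 < r -> dense_ratio r.
Proof.
move=> r1; apply: contrapT => nr.
pose E := [set s : R | 1 <= s /\ ~ dense_ratio s].
have Er : E r by split => //; exact: ltW.
have ubE : has_ubound E by exists (expR 25) => s [s1 ns]; exact: sparse_ratio_le.
have supE : has_sup E by split => //; exists r.
have [C CE] : exists C, C = sup E by exists (sup E).
have rC : r <= C by rewrite CE; apply: ub_le_sup.
have C1 : 1 < C by lra.
have C0 : 0 < C by lra.
(* Chosen with t and k so that 1 - t^-2, d and k are each at most b/4. Then 2 a <= 2 b = (1/4)(1 -
   1/C), as [full_chain] requires with sg = 1/4, and 2 - sg = 7/4 contradicts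
   [no_double_density]. *)
have [b bE] : exists b, b = (1 - C^-1) / 8 by exists ((1 - C^-1) / 8).
have iC1 : C^-1 < 1 by rewrite invf_lt1.
have iC0 : 0 < C^-1 by rewrite invr_gt0.
have b0 : 0 < b by lra.
have [t tE] : exists t, t = 1 + b / 8 by exists (1 + b / 8).
have t1 : 1 < t by lra.
have t0 : 0 < t by lra.
have bC : 1 - C^-1 <= C - 1.
  have : 0 <= (1 - C^-1) * (C - 1) by rewrite mulr_ge0 //; lra.
  by rewrite mulrBl mul1r mulrBr mulVf ?gt_eqF //; lra.
have [c cE] : exists c, c = C / t by exists (C / t).
have [w wE] : exists w, w = C * t by exists (C * t).
have cC : c < C by rewrite cE ltr_pdivrMr // ltr_pMr.
have Cw : C < w by rewrite wE ltr_pMr.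
have c1 : 1 <= c by rewrite cE ler_pdivlMr // mul1r; lra.
have w1 : 1 < w by lra.
have w0 : 0 < w by lra.
(* Sparseness passes to smaller ratios, and some sparse ratio exceeds c because c < C. *)
have cE' : ~ dense_ratio c.
  have [s [s1 ns] cs] : exists2 s, E s & c < s.
    have [s Es] := sup_adherent (ltr01 : 0 < 1) supE.
    by have := @sup_gt _ E c (ex_intro _ r Er); rewrite -CE => /(_ cC)[s' ? ?]; exists s'.
  move=> [eta eta0 [y0 Hy]]; apply: ns; exists eta => //; exists (Num.max y0 0) => y.
  rewrite ge_max => /andP[yy y00]; apply: (lt_le_trans (Hy y yy)).
  by rewrite lerB // Psi_mono // ler_wpM2r // ltW.
have [eta1 eta10 [y1 Hw]] : dense_ratio w.
  apply: contrapT => nw; have : w <= C by rewrite CE; apply: ub_le_sup => //; split => //; exact: ltW.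
  by lra.
have tt : 1 - (t * t)^-1 <= b / 4.
  have t2 : 0 < t * t by rewrite mulr_gt0.
  rewrite lerBlDr -lerBlDl -(ler_pM2r t2) mulVf ?gt_eqF // tE.
  have : 0 <= b * b by rewrite mulr_ge0 // ltW.
  have : 0 <= b * b * b by rewrite !mulr_ge0 // ltW.
  by lra.
clear tE bC.
have [k kE] : exists k, k = b / 4 by exists (b / 4).
have [eta2 eta2E] : exists e, e = eta1 / w by exists (eta1 / w).
have eta20 : 0 < eta2 by rewrite eta2E divr_gt0.
(* The chain reaches from w^2 N/(QY) to N/Y, a ratio of exactly e^60. *)
have [Q QE] : exists Q, Q = w * w * expR 60 by exists (w * w * expR 60).
have Q1 : 1 < Q.
  rewrite QE -[ltLHS]mulr1 ltr_pM ?ler01 //.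
    by rewrite -[ltLHS]mulr1 ltr_pM.
  by rewrite -expR0 ltr_expR.
have Q0 : 0 < Q by lra.
have lnQ : 0 < ln Q by rewrite ln_gt0.
have [i0 Hi0] := expr_unbounded (Num.max y1 1) Q1.
have k0 : 0 < k by lra.
have ek0 : 0 < eta2 * k by rewrite mulr_gt0.
(* About ln N/(2 ln Q) blocks share a non-full weight of roughly (d + et) ln N / k. This choice
   keeps the average at eta2/2, and the other half absorbs the constants. *)
have [et etE] : exists e, e = eta2 * k / (8 * ln Q) by exists (eta2 * k / (8 * ln Q)).
have et0 : 0 < et by rewrite etE divr_gt0 // mulr_gt0.
have [d dE] : exists d, d = Num.min k et by exists (Num.min k et).
have d0 : 0 < d by rewrite dE lt_min k0.
have dk : d <= k by rewrite dE ge_min lexx.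
have de : d <= et by rewrite dE ge_min lexx orbT.
have sgE : 2 * (2 * (1 - (t * t)^-1) + d + k) <= 1 / 4 * (1 - w^-1).
  have : w^-1 <= C^-1 by rewrite lef_pV2 ?posrE // ltW.
  by lra.
clear bE kE tt dE iC0 iC1 rC cC.
have [T T1 HU] := Psi_upper c1 d0.
have T0 : 0 < T by lra.
have [B HB] := not_full_weight c1 d0 k0 T1 HU.
(* The summands ensure, in order, that there is at least one block, that all blocks lie below N/T,
   and that the constants are absorbed. *)
have [L LE] : exists L, L = 2 * ln Q + 2 * (i0%:R * ln Q + ln T) +
  4 * ln Q * (`|B| + eta2 * k) / (eta2 * k) + 1.
  by eexists.
have lnT0 : 0 <= ln T by rewrite ln_ge0.
have L1 : 0 <= i0%:R * ln Q by rewrite mulr_ge0 // ltW.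
have L2 : 0 <= 4 * ln Q * (`|B| + eta2 * k) / (eta2 * k).
  by rewrite divr_ge0 ?(ltW ek0) // mulr_ge0 ?addr_ge0 // ?mulr_ge0 // ltW.
have [N NL hN] := sparse_ratio (Num.max T (expR L)) cE' et0.
move: NL; rewrite ge_max => /andP[TN LN].
have N0 : 0 < N by lra.
have lnN : L <= ln N by rewrite -ler_expR lnK.
have lN1 : 2 * ln Q <= ln N by lra.
have lN2 : 2 * (i0%:R * ln Q + ln T) <= ln N by lra.
have lN3 : 4 * ln Q * (`|B| + eta2 * k) / (eta2 * k) <= ln N by lra.
have lN0 : 0 < ln N by lra.
clear LE lnN L1 L2 LN.
have [m mE] : exists m, m = Num.truncn (ln N / (2 * ln Q)) by eexists.
have lnN0 : 0 <= ln N / (2 * ln Q) by rewrite divr_ge0 ?(ltW lN0) // mulr_ge0 // ltW.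
have /andP[m1 m2] := truncn_itv lnN0; rewrite -mE in m1 m2.
have m0 : (0 < m)%N.
  by rewrite mE truncn_gt0 ler_pdivlMr ?mul1r ?mulr_gt0.
have QN : Q ^+ (i0 + m) <= N / T.
  rewrite -ler_ln ?posrE ?exprn_gt0 ?divr_gt0 // lnXn // ln_div ?posrE // -mulr_natl natrD mulrDl.
  have : m%:R * ln Q <= ln N / 2.
    by move: m1; rewrite invfM mulrA ler_pdivlMr.
  by lra.
pose f l := if full c k N l then 0 else mangoldt l / l%:R : R.
have f0 l : 0 <= f l by rewrite /f; case: ifP => // _; rewrite divr_ge0 ?mangoldt_ge0.
have [i [/andP[i1 i2] Hi]] := sparse_block f0 (ltW Q1) QN m0.
have [Y YE] : exists Y, Y = Q ^+ i by eexists.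
have QYE : Q ^+ i.+1 = Q * Y by rewrite YE exprS.
rewrite -YE QYE in Hi.
have blk : \sum_((Num.truncn Y).+1 <= l < (Num.truncn (Q * Y)).+1) f l <= eta1 / w.
  rewrite -eta2E -(ler_pM2l (_ : 0 < m%:R)) ?ltr0n //; apply: (le_trans Hi).
  have -> : \sum_(1 <= l < (Num.truncn (N / T)).+1) f l =
     \sum_(1 <= l < (Num.truncn (N / T)).+1 | ~~ full c k N l) mangoldt l / l%:R.
    by rewrite [RHS]big_mkcond; apply: eq_bigr => l _; rewrite /f; case: ifP.
  apply: (le_trans (HB N et TN hN)); rewrite ler_pdivrMr //.
  have h1 : (d + et) * ln N <= eta2 * k * (ln N / (4 * ln Q)).
    have -> : eta2 * k * (ln N / (4 * ln Q)) = (et + et) * ln N.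
      by rewrite etE; field; rewrite gt_eqF.
    by rewrite ler_wpM2r ?(ltW lN0) // lerD2r.
  have h2 : `|B| + eta2 * k <= eta2 * k * (ln N / (4 * ln Q)).
    move: lN3.
    by rewrite ler_pdivrMr // => h; rewrite mulrA ler_pdivlMr ?mulr_gt0 // mulrC [leRHS]mulrC.
  have h3 : eta2 * k * (ln N / (2 * ln Q)) <= eta2 * k * (m%:R + 1).
    by rewrite ler_pM2l // natr1 ltW.
  have h4 : ln N / (2 * ln Q) = ln N / (4 * ln Q) + ln N / (4 * ln Q).
    by field; rewrite gt_eqF.
  rewrite h4 in h3; have := ler_norm B; lra.
have Y1 : Num.max y1 1 <= Y by rewrite YE; apply: Hi0.
move: Y1; rewrite ge_max => /andP[y1Y Y1].
have Y0 : 0 < Y by lra.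
have QY : Q * Y <= N / T.
  by apply: le_trans QN; rewrite -QYE ler_weXn2l // ltW.
have win y : Y <= y -> w * y <= Q * Y ->
    exists l : nat, [/\ y < l%:R, l%:R <= w * y & full c k N l].
  move=> Yy wy; apply: (@full_window w c k N Y Q y eta1) => //; first by lra.
  by apply: Hw; lra.
have QY0 : 0 < Q * Y by rewrite mulr_gt0.
have wct : w = c * (t * t) by rewrite cE wE mulrA divfK // gt_eqF.
have chain x := @full_chain R N Y Q w c t d k T (1 / 4) _ N0 Y0 Q0 w1 c1 (ltW t1) wct
  (ltW d0) (ltW k0) T1 HU QY win erefl sgE x.
apply: (@no_double_density (w * w * N / (Q * Y)) (N / Y)).
- have : T <= N / (Q * Y) by rewrite ler_pdivlMr // mulrC -ler_pdivlMr.
  have : 1 <= w * w by rewrite mulr_ege1 // ltW.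
  move=> ww h; rewrite -mulrA; apply: le_trans (_ : 1 * 1 <= _); first by rewrite mulr1.
  by apply: ler_pM => //; lra.
- rewrite le_eqVlt; apply/orP; left; apply/eqP.
  rewrite QE; field; rewrite !gt_eqF ?expR_gt0 //.
- move=> x x0 xY; apply: le_trans (chain x x0 xY); lra.
Qed.

End ShortIntervals.

(** * From prime powers to primes *)

Section PrimeIntervals.
Variable R : realType.
Local Notation mangoldt := (@mangoldt R).

Lemma mangoldt_neq0 (n : nat) : mangoldt n != 0 ->
  [/\ prime (pdiv n), n = (pdiv n ^ logn (pdiv n) n)%N, (1 < n)%N
    & mangoldt n = ln (pdiv n)%:R].
Proof.
rewrite /mangoldt; case E: (primes n) => [|p [|]]; rewrite ?eqxx // => _.
have : p \in primes n by rewrite E inE.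
rewrite mem_primes => /and3P[pp n0 pn].
have nE : n = (p ^ logn p n)%N.
  by rewrite {1}(prod_prime_decomp n0) prime_decompE big_map /= E big_seq1.
have l0 : (0 < logn p n)%N by rewrite logn_gt0 E inE.
have pE : pdiv n = p by rewrite nE -(prednK l0) pdiv_pfactor.
rewrite pE; split => //.
by rewrite nE -(exp1n (logn p n)) ltn_exp2r // prime_gt1.
Qed.

(** Only proper prime powers remain in ]x, rx], with bases at most sqrt(rx). As r <= 2, two powers
    of the same prime cannot both lie there, so the base determines the power. *)
Lemma mangoldt_noprime_sum (x r : R) : 1 <= x -> 1 <= r -> r <= 2 ->
  (forall p : nat, prime p -> x < p%:R -> r * x < p%:R) ->
  Psi (r * x) - Psi x <= Num.sqrt (r * x) * ln (r * x).
Proof.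
move=> x1 r1 r2 np; have x0 : 0 < x by lra.
have xr : x <= r * x by rewrite ler_peMl // ltW.
have rx0 : 0 < r * x by lra.
rewrite sum_nat_diff ?le_truncn //.
set s := [seq n <- index_iota (Num.truncn x).+1 (Num.truncn (r * x)).+1 | mangoldt n != 0].
have sP n : n \in s -> [/\ x < n%:R, n%:R <= r * x & mangoldt n != 0].
  rewrite mem_filter mem_index_iota => /andP[n0 /andP[xn nx]]; split => //.
    by move: xn; rewrite truncn_lt_nat // ltW.
  by move: nx; rewrite ltnS truncn_ge_nat // ltW.
have -> : \sum_((Num.truncn x).+1 <= i < (Num.truncn (r * x)).+1) mangoldt i =
    \sum_(i <- s) mangoldt i.
  rewrite big_filter [RHS]big_mkcond; apply: eq_bigr => i _.
  by case: eqP => [->|].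
have bnd : \sum_(i <- s) mangoldt i <= \sum_(i <- s) ln (r * x).
  rewrite big_seq [leRHS]big_seq; apply: ler_sum => n /sP[xn nx /mangoldt_neq0[pp nE n1 ->]].
  have p0 := prime_gt0 pp.
  rewrite ler_ln ?posrE ?ltr0n //; apply: le_trans nx; rewrite ler_nat.
  by apply: dvdn_leq; rewrite ?pdiv_dvd // ltnW.
apply: (le_trans bnd); rewrite big_const_seq count_predT iter_addr addr0 -mulr_natl.
rewrite ler_wpM2r ?ln_ge0 //; first by lra.
have inj : {in s &, injective pdiv}.
  have aux i j p : (0 < i)%N -> (1 < p)%N -> x < (p ^ i)%:R -> (p ^ j)%:R <= r * x -> (j <= i)%N.
    move=> i0 p1 h1 h2; rewrite leqNgt; apply/negP => ij.
    have : (p * p ^ i)%:R <= (p ^ j)%:R :> R.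
      by rewrite ler_nat -expnS leq_exp2l.
    have : 2 * (p ^ i)%:R <= (p * p ^ i)%:R :> R by rewrite -natrM ler_nat leq_mul2r p1 orbT.
    have : r * x <= 2 * x by rewrite ler_pM2r.
    lra.
  move=> n m /sP[xn nx /mangoldt_neq0[pp nE n1 _]] /sP[xm mx /mangoldt_neq0[pq mE m1 _]] e.
  have p1 := prime_gt1 pp.
  rewrite -e in mE; move: nE mE; move: (pdiv n) (logn _ n) (logn _ m) p1 => p i j p1 nE mE.
  subst n m; congr (_ ^ _)%N; apply/eqP; rewrite eqn_leq.
  have i0 : (0 < i)%N by move: n1; case: (i).
  have j0 : (0 < j)%N by move: m1; case: (j).
  by rewrite (aux j i p) // (aux i j p).
have : (size [seq pdiv n | n <- s] <= size (index_iota 1 (Num.truncn (Num.sqrt (r * x))).+1))%N.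
  apply: uniq_leq_size.
    by rewrite map_inj_in_uniq // filter_uniq // iota_uniq.
  move=> _ /mapP[n /sP[xn nx /mangoldt_neq0[pp nE n1 _]] ->].
  rewrite mem_index_iota prime_gt0 // ltnS truncn_ge_nat ?sqrtr_ge0 //.
  rewrite -(ler_pXn2r (isT : (0 < 2)%N)) ?nnegrE ?sqrtr_ge0 // sqr_sqrtr ?(ltW rx0) //.
  apply: (le_trans _ nx); rewrite -natrX ler_nat [leqRHS]nE leq_exp2l ?(prime_gt1 pp) //.
  move: nE; case: (logn _ _) => [|[|//]] nE.
    by move: n1; rewrite nE.
  rewrite expn1 in nE; have := np n; rewrite nE => /(_ pp); rewrite -nE => /(_ xn).
  by rewrite ltNge nx.
rewrite size_map size_iota subn1 /= -(ler_nat R) => /le_trans; apply.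
by rewrite truncn_le sqrtr_ge0.
Qed.

Lemma prime_short_intervals (r : R) : 1 < r ->
  exists x0 : R, forall x, x0 <= x -> exists p : nat, [/\ prime p, x < p%:R & p%:R <= r * x].
Proof.
move=> r1; wlog r2 : r r1 / r <= 2.
  move=> H; have [h|h] := leP r 2; first exact: H.
  have [x0 Hx] := H 2 (ltac:(lra)) (lexx _).
  exists (Num.max x0 0) => x; rewrite ge_max => /andP[xx xge0].
  have [p [pp p1 p2]] := Hx x xx; exists p; split => //; apply: (le_trans p2).
  by rewrite ler_wpM2r // ltW.
have [eta eta0 [y0 Hy]] := Psi_short_intervals r1.
(* The fourth power of sqrt(y) ln y, with y = rx <= 2x, is at most y^2 (16 sqrt y)^2 = 256 y^3 <=
   2048 x^3. *)
exists (Num.max y0 (Num.max 1 (2048 / eta ^+ 4))) => x.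
rewrite !ge_max => /and3P[xy x1 xe].
apply: contrapT => H; have := Hy x xy; apply/negP; rewrite -leNgt.
have x0 : 0 < x by lra.
apply: le_trans (mangoldt_noprime_sum x1 (ltW r1) r2 _) _.
  by move=> p pp xp; rewrite ltNge; apply/negP => prx; apply: H; exists p.
set y := r * x.
have y1 : 1 <= y by rewrite /y mulr_ege1 // ltW.
have yx : y <= 2 * x by rewrite ler_pM2r.
have y0' : 0 < y by lra.
have s0 : 0 <= Num.sqrt y := sqrtr_ge0 y.
have s2 : Num.sqrt y ^+ 2 = y by rewrite sqr_sqrtr // ltW.
have l0 : 0 <= ln y by rewrite ln_ge0.
have l1 := sqr_ln_le_sqrt y1.
have e4 : 0 < eta ^+ 4 by rewrite exprn_gt0.
have ex : 2048 <= eta ^+ 4 * x by rewrite mulrC -ler_pdivrMr.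
have pos2 : (0 < 2)%N by [].
rewrite -(ler_pXn2r pos2) ?nnegrE ?mulr_ge0 ?(ltW eta0) ?(ltW x0) //.
rewrite -(ler_pXn2r pos2) ?nnegrE ?exprn_ge0 ?mulr_ge0 ?(ltW eta0) ?(ltW x0) //.
have -> : (Num.sqrt y * ln y) ^+ 2 ^+ 2 = y ^+ 2 * (ln y ^+ 2) ^+ 2.
  by rewrite -{3}s2; ring.
apply: (@le_trans _ _ (y ^+ 2 * (16 * Num.sqrt y) ^+ 2)).
  by rewrite ler_wpM2l ?exprn_ge0 ?(ltW y0') // lerXn2r ?nnegrE ?exprn_ge0 ?mulr_ge0.
have q : 16 ^+ 2 = 256 :> R by rewrite -natrX.
rewrite [(16 * _) ^+ 2]exprMn s2 q mulrCA -exprSr.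
apply: (@le_trans _ _ (256 * (2 * x) ^+ 3)).
  by rewrite ler_pM2l // lerXn2r // nnegrE ?(ltW y0') // mulr_ge0 // ltW.
have -> : (eta * x) ^+ 2 ^+ 2 = (eta ^+ 4 * x) * x ^+ 3 by ring.
have -> : 256 * (2 * x) ^+ 3 = 2048 * x ^+ 3 by ring.
by rewrite ler_pM2r // exprn_gt0.
Qed.

End PrimeIntervals.

(** * Lattice points in balls *)

Section GaussSum.
Variable R : realType.
Local Notation Ig := (@gauss_integral_proof.integral0_gauss R).
Local Notation mu := (@lebesgue_measure R).

Lemma gauss_increment (a b : R) : 0 <= a -> a < b ->
  gauss_fun b * (b - a) <= Ig b - Ig a <= gauss_fun a * (b - a).
Proof.
move=> a0 ab; have b0 : 0 < b by lra.
have itg x : mu.-integrable `[0, x] (EFin \o (@gauss_fun R)).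
  apply: continuous_compact_integrable; first exact: segment_compact.
  by apply: continuous_subspaceT; exact: continuous_gauss_fun.
have [c] : exists2 c, c \in `]a, b[%R & Ig b - Ig a = gauss_fun c * (b - a).
  apply: MVT => // [x|].
    rewrite in_itv /= => /andP[ax _]; have x0 : 0 < x by lra.
    have [d1 d2] : derivable Ig x 1 /\ derive1 Ig x = gauss_fun x.
      apply: (@continuous_FTC1 R (@gauss_fun R) (BLeft 0) _ (x + 1) _ _ _ _).
      - by rewrite ltrDl.
      - exact: itg.
      - by rewrite /= lte_fin.
      - exact: continuous_gauss_fun.
    by apply: DeriveDef; [exact: d1 | rewrite -derive1E].
  apply: (@continuous_subspaceW _ _ _ `[0, b]).
    by apply: subset_itvr; rewrite bnd_simp.
  by apply: parameterized_integral_continuous; [exact: ltW|exact: itg].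
rewrite in_itv /= => /andP[ac cb] ->.
have ba : 0 < b - a by lra.
rewrite !ler_pM2r // /gauss_fun !ler_expR !lerN2 !lerXn2r ?nnegrE //; lra.
Qed.

Lemma gauss_sum_bounds (h : R) (K : nat) : 0 < h ->
  h * \sum_(1 <= j < K.+1) gauss_fun (h * j%:R) <= Ig (h * K%:R) <=
  h * (1 + \sum_(1 <= j < K.+1) gauss_fun (h * j%:R)).
Proof.
move=> h0.
have Ig0 : Ig 0 = 0 by rewrite /Ig set_itv1 Rintegral_set1.
have inc (j : nat) : gauss_fun (h * j.+1%:R) * h <= Ig (h * j.+1%:R) - Ig (h * j%:R)
    <= gauss_fun (h * j%:R) * h.
  have e : h * j.+1%:R - h * j%:R = h by rewrite -natr1; ring.
  rewrite -[X in _ * X <= _]e -[X in _ <= _ * X]e; apply: gauss_increment.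
    by rewrite mulr_ge0 // ltW.
  by rewrite ltr_pM2l // ltr_nat.
have tel : \sum_(0 <= j < K) (Ig (h * j.+1%:R) - Ig (h * j%:R)) = Ig (h * K%:R).
  by rewrite telescope_sumr // mulr0 Ig0 subr0.
rewrite -tel big_add1 /=; apply/andP; split.
  by rewrite mulr_sumr; apply: ler_sum_nat => j _; rewrite mulrC; have /andP[] := inc j.
apply: (@le_trans _ _ (h * \sum_(0 <= j < K) gauss_fun (h * j%:R))).
  by rewrite mulr_sumr; apply: ler_sum_nat => j _; rewrite [leRHS]mulrC; have /andP[] := inc j.
rewrite ler_pM2l //; have g1 : gauss_fun (h * 0%:R) = 1 :> R.
  by rewrite mulr0 /gauss_fun expr0n oppr0 expR0.
have -> : 1 + \sum_(0 <= j < K) gauss_fun (h * j.+1%:R) =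
    \sum_(0 <= j < K.+1) gauss_fun (h * j%:R) by rewrite big_nat_recl // g1.
rewrite big_nat_recr //= lerDl.
exact: gauss_fun_ge0.
Qed.

Lemma cvg_gauss_int : Ig x @[x --> +oo] --> Num.sqrt pi / 2.
Proof.
have : Num.sqrt (Ig x ^+ 2) @[x --> +oo] --> Num.sqrt (pi / 4).
  apply: continuous_cvg; first exact: sqrt_continuous.
  exact: gauss_integral_proof.cvg_integral0_gauss_sqr.
have -> : Num.sqrt (pi / 4) = Num.sqrt pi / 2 :> R.
  by rewrite sqrtrM ?pi_ge0 // sqrtrV // (_ : 4 = 2 ^+ 2) ?sqrtr_sqr ?ger0_norm // -natrX.
apply: cvg_trans; apply: near_eq_cvg; near=> x.
by rewrite sqrtr_sqr ger0_norm // gauss_integral_proof.integral0_gauss_ge0.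
Unshelve. all: end_near. Qed.

Lemma sum_symmetric (F : R -> R) (K : nat) : (forall x, F (- x) = F x) ->
  \sum_(i < (2 * K).+1) F (i%:R - K%:R) = F 0 + 2 * \sum_(1 <= j < K.+1) F j%:R.
Proof.
move=> Fs; rewrite -(big_mkord xpredT (fun i => F (i%:R - K%:R))).
rewrite (@big_cat_nat _ _ _ K) //=; last by rewrite mul2n -addnn leqW // leq_addr.
rewrite [X in _ + X]big_ltn; last by rewrite ltnS mul2n -addnn leq_addr.
rewrite subrr addrCA; congr (_ + _); rewrite mulr2n mulrDl mul1r; congr (_ + _).
  rewrite big_nat_rev /= add0n big_add1 /=; apply: eq_big_nat => j jK.
  by rewrite natrB // -Fs; congr F; ring.
rewrite -{1}[K.+1]add0n big_addn subSS mul2n -addnn addnK [RHS]big_add1 /=.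
by apply: eq_big_nat => j _; rewrite -addSnnS natrD addrK.
Qed.

(** A grid of mesh 1/M reaching from -M to M, so that a single limit in M refines the mesh and
    extends the range. *)
Definition gauss_sum (lam : R) (M : nat) : R :=
  \sum_(i < (2 * M ^ 2).+1) expR (- (lam * ((i%:R - (M ^ 2)%:R) / M%:R) ^+ 2)).

Lemma cvg_gauss_sum (lam : R) : 0 < lam ->
  (gauss_sum lam M / M%:R @[M --> \oo] --> Num.sqrt (pi / lam)).
Proof.
move=> l0; have sl0 : 0 < Num.sqrt lam by rewrite sqrtr_gt0.
pose h (M : nat) := Num.sqrt lam / M%:R.
pose S (M : nat) := \sum_(1 <= j < (M ^ 2).+1) gauss_fun (h M * j%:R).
have ZE M : gauss_sum lam M = 1 + 2 * S M.
  rewrite /gauss_sum (sum_symmetric (F := fun x => expR (- (lam * (x / M%:R) ^+ 2)))).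
    rewrite mul0r expr0n mulr0 oppr0 expR0; congr (_ + 2 * _).
    apply: eq_bigr => j _; rewrite /gauss_fun /h; congr (expR (- _)).
    have -> : Num.sqrt lam / M%:R * j%:R = Num.sqrt lam * (j%:R / M%:R) by ring.
    by rewrite [in RHS]exprMn sqr_sqrtr // ltW.
  by move=> x; rewrite mulNr sqrrN.
have hcvg : h M @[M --> \oo] --> 0.
  rewrite -(mulr0 (Num.sqrt lam)); apply: cvgM; first exact: cvg_cst.
  apply/gtr0_cvgV0; last exact: cvgr_idn.
  by near=> n; rewrite ltr0n; near: n; exact: nbhs_infty_gt.
have Icvg : Ig (Num.sqrt lam * M%:R) @[M --> \oo] --> Num.sqrt pi / 2.
  apply: (cvg_comp (fun M : nat => Num.sqrt lam * M%:R) Ig _ cvg_gauss_int).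
  apply/cvgryPge => A.
  by apply: filterS (nbhs_infty_ger (A / Num.sqrt lam)) => n; rewrite ler_pdivrMr // mulrC.
have E : Num.sqrt (pi / lam) = Num.sqrt pi / Num.sqrt lam :> R.
  by rewrite sqrtrM ?pi_ge0 // sqrtrV // ltW.
rewrite E.
apply: (@squeeze_cvgr _ _ _ _ (fun M => (2 * Ig (Num.sqrt lam * M%:R) - h M) / Num.sqrt lam)
  (fun M => (2 * Ig (Num.sqrt lam * M%:R) + h M) / Num.sqrt lam)).
- near=> M.
  have M0 : 0 < M%:R :> R by rewrite ltr0n; near: M; exact: nbhs_infty_gt.
  have h0 : 0 < h M by rewrite divr_gt0.
  have := gauss_sum_bounds (M ^ 2) h0.
  have -> : h M * (M ^ 2)%:R = Num.sqrt lam * M%:R.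
    by rewrite /h natrX; field; rewrite gt_eqF.
  rewrite -/(S M) => /andP[s1 s2].
  have -> : gauss_sum lam M / M%:R = (h M * gauss_sum lam M) / Num.sqrt lam.
    by rewrite /h; field; rewrite !gt_eqF.
  by rewrite ZE !ler_pM2r ?invr_gt0 //; apply/andP; split; lra.
- have -> : Num.sqrt pi / Num.sqrt lam = (2 * (Num.sqrt pi / 2) - 0) / Num.sqrt lam :> R.
    by congr (_ / _); rewrite subr0; field.
  apply: cvgM; last exact: cvg_cst.
  by apply: cvgB => //; apply: cvgM => //; exact: cvg_cst.
- have -> : Num.sqrt pi / Num.sqrt lam = (2 * (Num.sqrt pi / 2) + 0) / Num.sqrt lam :> R.
    by congr (_ / _); rewrite addr0; field.
  apply: cvgM; last exact: cvg_cst.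
  by apply: cvgD => //; apply: cvgM => //; exact: cvg_cst.
Unshelve. all: end_near. Qed.

End GaussSum.

(** * Counting by exponential tilting *)

Section LatticeCount.
Variable R : realType.

Lemma sum_expR_ffun (I : finType) (h : I -> R) (n : nat) (l : R) :
  \sum_(y : {ffun 'I_n -> I}) expR (- (l * \sum_i h (y i))) =
  (\sum_i expR (- (l * h i))) ^+ n.
Proof.
rewrite -[n in RHS]card_ord -prodr_const bigA_distr_bigA /=; apply: eq_bigr => y _.
rewrite mulr_sumr -sumrN.
by rewrite (big_morph expR (@expRD R) (@expR0 R)).
Qed.

(** Give y the weight exp(-l sum h(y_i)), of total Z(l)^n. The two hypotheses are Chernoff bounds:
    sums above n t and sums below n t' each carry at most q^n of the total. Every point in between
    weighs at most exp(-l n t'), so there must be many of them. *)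
Lemma chernoff_count (I : finType) (h : I -> R) (n : nat) (l eta t t' q : R) :
  let Z l := \sum_i expR (- (l * h i)) in
  0 < l -> 0 < eta -> 0 <= q ->
  expR (- (eta * t)) * Z (l - eta) <= q * Z l ->
  expR (eta * t') * Z (l + eta) <= q * Z l ->
  (1 - 2 * q ^+ n) * (expR (l * t') * Z l) ^+ n <=
  #|[pred y : {ffun 'I_n -> I} | \sum_i h (y i) <= n%:R * t]|%:R.
Proof.
move=> Z l0 eta0 q0 up low; set P := [pred y | _].
have Z0 x : 0 <= Z x by apply: sumr_ge0 => i _; exact: expR_ge0.
have key (y : {ffun 'I_n -> I}) : expR (- (l * \sum_i h (y i))) <=
    (if P y then expR (- (l * (n%:R * t'))) else 0) +
    (expR (- (eta * (n%:R * t))) * expR (- ((l - eta) * \sum_i h (y i))) +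
     expR (eta * (n%:R * t')) * expR (- ((l + eta) * \sum_i h (y i)))).
  rewrite /P /=; move: (\sum_i h (y i)) => s; rewrite -!expRD.
  have [su|su] := leP s (n%:R * t); last first.
    rewrite add0r -[leLHS]addr0; apply: lerD; last exact: expR_ge0.
    rewrite ler_expR; have : eta * (n%:R * t) <= eta * s by rewrite ler_pM2l // ltW.
    lra.
  have [sl|sl] := leP (n%:R * t') s.
    rewrite -[leLHS]addr0; apply: lerD; last by rewrite addr_ge0 // expR_ge0.
    by rewrite ler_expR lerN2 ler_pM2l.
  rewrite -[leLHS]add0r -[expR (- (l * s))]add0r; apply: lerD; first exact: expR_ge0.
  apply: lerD; first exact: expR_ge0.
  rewrite ler_expR; have : eta * s <= eta * (n%:R * t') by rewrite ler_pM2l // ltW.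
  lra.
have := ler_sum (index_enum _) (fun y (_ : true) => key y).
rewrite sum_expR_ffun big_split big_split /= -!mulr_sumr !sum_expR_ffun -big_mkcond sumr_const.
rewrite -/(Z l) -/(Z (l - eta)) -/(Z (l + eta)).
have -> : expR (- (eta * (n%:R * t))) = expR (- (eta * t)) ^+ n.
  by rewrite -expRM_natl; congr expR; ring.
have -> : expR (eta * (n%:R * t')) = expR (eta * t') ^+ n.
  by rewrite -expRM_natl; congr expR; ring.
have -> : expR (- (l * (n%:R * t'))) = (expR (l * t') ^+ n)^-1.
  by rewrite -expRM_natl -expRN; congr expR; ring.
rewrite -!exprMn => main.
have up' : (expR (- (eta * t)) * Z (l - eta)) ^+ n <= (q * Z l) ^+ n.
  by rewrite lerXn2r ?nnegrE ?mulr_ge0 ?expR_ge0.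
have low' : (expR (eta * t') * Z (l + eta)) ^+ n <= (q * Z l) ^+ n.
  by rewrite lerXn2r ?nnegrE ?mulr_ge0 ?expR_ge0.
have e0 : 0 < expR (l * t') ^+ n by rewrite exprn_gt0 // expR_gt0.
rewrite [(expR (l * t') * Z l) ^+ n]exprMn mulrCA mulrC -ler_pdivlMr //.
rewrite [leRHS]exprMn in up'; rewrite [leRHS]exprMn in low'.
rewrite -[_^-1 *+ _]mulr_natl in main.
have main' : Z l ^+ n <= #|P|%:R / expR (l * t') ^+ n +
    ((expR (- (eta * t)) * Z (l - eta)) ^+ n + (expR (eta * t') * Z (l + eta)) ^+ n) := main.
lra.
Qed.

(** The ball of squared radius n t has volume (sqrt(2 pi e t) + o(1))^n. The tilting weights are
    Gaussian, with Z(l)/M tending to sqrt(pi/l). *)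
Lemma lattice_count (t B : R) : 0 < t -> 0 < B -> B ^+ 2 < 2 * pi * expR 1 * t ->
  exists M K n0 : nat, (0 < M)%N /\ forall n, (n0 <= n)%N ->
  (M%:R * B) ^+ n <=
  #|[pred y : {ffun 'I_n -> 'I_(2 * K).+1} |
      \sum_i (((y i)%:R - K%:R) / M%:R : R) ^+ 2 <= n%:R * t]|%:R.
Proof.
move=> t0 B0 BE; have pi0 := pi_gt0 R.
have V0 : 0 < 2 * pi * expR 1 * t by rewrite !mulr_gt0 ?expR_gt0.
have [V VE] : exists V, V = 2 * pi * expR 1 * t by eexists.
rewrite -VE in V0 BE.
have [d dE] : exists d, d = (1 - B ^+ 2 / V) / 4 by eexists.
have BV : B ^+ 2 / V < 1 by rewrite ltr_pdivrMr ?mul1r.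
have BV0 : 0 < B ^+ 2 / V by rewrite divr_gt0 // exprn_gt0.
have d0 : 0 < d by lra.
have d1 : d < 1 / 4 by lra.
have Bd : B ^+ 2 = V * (1 - 4 * d).
  by rewrite dE; field; rewrite gt_eqF.
(* Under the density proportional to exp(-l x^2) the mean of x^2 is 1/(2l) = t/(1+d), strictly
   between t' = t/(1+d)^2 and t. As d tends to 0, e^(l t') sqrt(pi/l) tends to sqrt(2 pi e t). *)
have [l lE] : exists l, l = (1 + d) / (2 * t) by eexists.
have l0 : 0 < l by rewrite lE divr_gt0 //; lra.
have [t' t'E] : exists t', t' = t / (1 + d) ^+ 2 by eexists.
(* The upper tail needs 1/(1-s) < 1+d, the lower tail s < d. *)
have [s sE] : exists s, s = d / (2 * (1 + d)) by eexists.
have D0 : 0 < 1 + d by lra.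
have s0 : 0 < s by rewrite sE divr_gt0 // mulr_gt0.
have sd : s * (2 * (1 + d)) = d by rewrite sE divfK // gt_eqF // mulr_gt0.
have s1 : s < 1 by rewrite sE ltr_pdivrMr ?mulr_gt0 //; lra.
have sd' : s < d by rewrite sE ltr_pdivrMr ?mulr_gt0 // ltr_pMr //; lra.
have [eta etaE] : exists eta, eta = s * l by eexists.
have eta0 : 0 < eta by rewrite etaE mulr_gt0.
have le0 : 0 < l - eta by rewrite etaE -{1}[l]mul1r -mulrBl mulr_gt0 //; lra.
have et : eta * t = s * (1 + d) / 2.
  by rewrite etaE lE; field; rewrite gt_eqF.
have et' : eta * t' = s / (1 + d) / 2.
  by rewrite etaE lE t'E; field; rewrite !gt_eqF.
have lt' : l * t' = (1 + d)^-1 / 2.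
  by rewrite lE t'E; field; rewrite !gt_eqF.
pose g (x : R) := Num.sqrt (pi / x).
have g0 x : 0 < x -> 0 < g x by move=> x0; rewrite sqrtr_gt0 divr_gt0.
have gl (x y : R) : 0 < x -> 0 < y -> g (x * y) = g x / Num.sqrt y.
  by move=> x0 y0; rewrite /g invfM mulrA sqrtrM ?sqrtrV // ?divr_ge0 // ltW.
have sq_exp (a b : R) : 0 < b -> a < ln b -> expR (a / 2) < Num.sqrt b.
  move=> b0 ab; rewrite -(ltr_pXn2r (isT : (0 < 2)%N)) ?nnegrE ?expR_ge0 ?sqrtr_ge0 //.
  by rewrite sqr_sqrtr ?ltW // -expRM_natl mulrC divfK // -ltr_ln ?posrE ?expR_gt0 // expRK.
have lim1 : expR (- (eta * t)) * g (l - eta) < g l.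
  have -> : l - eta = l * (1 - s) by rewrite etaE; ring.
  have s1' : 0 < 1 - s by lra.
  rewrite gl // mulrA ltr_pdivrMr ?sqrtr_gt0 // mulrC ltr_pM2l ?g0 //.
  rewrite et -mulNr; apply: sq_exp => //.
  have h1 : - ln (1 - s) <= s / (1 - s).
    rewrite -lnV ?posrE // [X in ln X](_ : _ = 1 + s / (1 - s)); last by field; rewrite gt_eqF.
    by apply: le_ln1Dx; apply: (lt_trans (ltrN10 _)); rewrite divr_gt0.
  have h2 : s / (1 - s) < s * (1 + d).
    rewrite ltr_pM2l // -[ltLHS]mul1r ltr_pdivrMr //.
    have : s * d <= s * (1 / 4) by rewrite ler_pM2l // ltW.
    lra.
  lra.
have lim2 : expR (eta * t') * g (l + eta) < g l.
  have -> : l + eta = l * (1 + s) by rewrite etaE; ring.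
  have s1' : 0 < 1 + s by lra.
  rewrite gl // mulrA ltr_pdivrMr ?sqrtr_gt0 // mulrC ltr_pM2l ?g0 //.
  rewrite et'; apply: sq_exp => //.
  have h1 : s / (1 + s) <= ln (1 + s).
    rewrite -lerN2 -lnV ?posrE // [X in ln X](_ : _ = 1 + - (s / (1 + s))); last first.
      by field; rewrite gt_eqF.
    by apply: le_ln1Dx; rewrite ltrN2 ltr_pdivrMr //; lra.
  apply: lt_le_trans h1; rewrite ltr_pM2l // ltf_pV2 ?posrE //; lra.
have lim3 : B < expR (l * t') * g l.
  rewrite -(ltr_pXn2r (isT : (0 < 2)%N)) ?nnegrE ?mulr_ge0 ?expR_ge0 ?ltW // ?g0 //.
  have e2 : expR (l * t') ^+ 2 = expR (1 + d)^-1.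
    by rewrite -expRM_natl lt' mulrC divfK.
  rewrite exprMn e2 /g sqr_sqrtr ?divr_ge0 ?ltW //.
  have h1 : expR 1 * (1 - d) <= expR (1 + d)^-1.
    have -> : (1 + d)^-1 = 1 + (- (d / (1 + d))) by field; rewrite gt_eqF.
    rewrite expRD ler_pM2l ?expR_gt0 //.
    apply: le_trans (expR_ge1Dx _); rewrite lerD2l lerN2 ler_pdivrMr //.
    by have := mulr_gt0 d0 d0; lra.
  have h2 : 1 - d <= (1 + d)^-1.
    by rewrite -[leRHS]mul1r ler_pdivlMr //; have := mulr_gt0 d0 d0; lra.
  have -> : pi / l = 2 * pi * t * (1 + d)^-1.
    by rewrite lE; field; rewrite !gt_eqF.
  rewrite Bd VE.
  apply: (@lt_le_trans _ _ (expR 1 * (1 - d) * (2 * pi * t * (1 - d)))).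
    have -> : 2 * pi * expR 1 * t * (1 - 4 * d) = expR 1 * 2 * pi * t * (1 - 4 * d) by ring.
    have -> : expR 1 * (1 - d) * (2 * pi * t * (1 - d)) = expR 1 * 2 * pi * t * ((1 - d) * (1 - d)) by ring.
    rewrite ltr_pM2l ?mulr_gt0 ?expR_gt0 //; have := mulr_gt0 d0 d0.
    lra.
  apply: ler_pM => //.
  - by rewrite mulr_ge0 ?expR_ge0 //; lra.
  - by rewrite mulr_ge0 ?ltW ?mulr_gt0 //; lra.
  by rewrite ler_pM2l ?mulr_gt0.
clear VE V0 BE dE BV BV0 Bd lE t'E sE sd s1 sd' etaE et et' lt' d0 d1 D0 s0.
have [q [q0 q1 lim1' lim2']] : exists q, [/\ 0 <= q, q < 1,
    expR (- (eta * t)) * g (l - eta) < q * g l & expR (eta * t') * g (l + eta) < q * g l].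
  have gl0 : 0 < g l by exact: g0.
  have [m [m1 m2 m3]] : exists m, [/\ expR (- (eta * t)) * g (l - eta) <= m,
      expR (eta * t') * g (l + eta) <= m & m < g l].
    exists (Num.max (expR (- (eta * t)) * g (l - eta)) (expR (eta * t') * g (l + eta))).
    by rewrite !le_max !lexx orbT gt_max lim1.
  have m0 : 0 <= m by apply: le_trans m1; rewrite mulr_ge0 ?expR_ge0 ?ltW ?g0.
  exists ((m + g l) / 2 / g l); rewrite divfK ?gt_eqF //; split; first 1 last.
  - by rewrite ltr_pdivrMr // mul1r; lra.
  - by lra.
  - by lra.
  - by rewrite divr_ge0 ?ltW //; lra.
(* The spare factor (B'/B)^n outweighs the loss 1 - 2 q^n, which is at least 1/2 for large n. *)
have [B' [BB' B'lim]] : exists B', B < B' /\ B' < expR (l * t') * g l.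
  by exists ((B + expR (l * t') * g l) / 2); split; lra.
have B'0 : 0 < B' by lra.
have c1 : expR (- (eta * t)) * (gauss_sum (l - eta) M / M%:R) @[M --> \oo]
    --> expR (- (eta * t)) * g (l - eta).
  by apply: cvgM; [exact: cvg_cst | exact: cvg_gauss_sum].
have c2 : expR (eta * t') * (gauss_sum (l + eta) M / M%:R) @[M --> \oo]
    --> expR (eta * t') * g (l + eta).
  by apply: cvgM; [exact: cvg_cst | apply: cvg_gauss_sum; rewrite addr_gt0].
have c3 : gauss_sum l M / M%:R @[M --> \oo] --> g l by exact: cvg_gauss_sum.
(* The mesh is fixed before n: the limit concerns a single coordinate, and strict inequalities there
   survive n-th powers. *)
have [M [M0 u1 u2 u3]] : exists M : nat, [/\ (0 < M)%N,
    expR (- (eta * t)) * (gauss_sum (l - eta) M / M%:R) <= q * (gauss_sum l M / M%:R),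
    expR (eta * t') * (gauss_sum (l + eta) M / M%:R) <= q * (gauss_sum l M / M%:R) &
    B' <= expR (l * t') * (gauss_sum l M / M%:R)].
  have cq : q * (gauss_sum l M / M%:R) @[M --> \oo] --> q * g l.
    by apply: cvgM; [exact: cvg_cst | exact: c3].
  have cB : expR (l * t') * (gauss_sum l M / M%:R) @[M --> \oo] --> expR (l * t') * g l.
    by apply: cvgM; [exact: cvg_cst | exact: c3].
  pose m1 := (expR (- (eta * t)) * g (l - eta) + q * g l) / 2.
  pose m2 := (expR (eta * t') * g (l + eta) + q * g l) / 2.
  have a1 : expR (- (eta * t)) * g (l - eta) < m1 by rewrite /m1; lra.
  have a2 : m1 < q * g l by rewrite /m1; lra.
  have a3 : expR (eta * t') * g (l + eta) < m2 by rewrite /m2; lra.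
  have a4 : m2 < q * g l by rewrite /m2; lra.
  apply: (@filter_ex _ \oo); near=> M; split.
  - by near: M; exact: nbhs_infty_gt.
  - apply: (@le_trans _ _ m1); near: M; [exact: cvgr_le c1 _ a1 | exact: cvgr_ge cq _ a2].
  - apply: (@le_trans _ _ m2); near: M; [exact: cvgr_le c2 _ a3 | exact: cvgr_ge cq _ a4].
  - by near: M; exact: cvgr_ge cB _ B'lim.
have M0' : 0 < M%:R :> R by rewrite ltr0n.
rewrite !mulrA !ler_pM2r ?invr_gt0 // in u1 u2.
rewrite mulrA ler_pdivlMr // in u3.
have iq1 : 1 < q^-1 \/ q = 0.
  have [->|qn0] := eqVneq q 0; first by right.
  by left; rewrite invf_gt1 // lt_def qn0.
have [n1 Hn1] : exists n1 : nat, forall n, (n1 <= n)%N -> q ^+ n <= 1 / 4.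
  case: iq1 => [iq1|->]; last first.
    by exists 1%N => -[//|n] _; rewrite expr0n /=; lra.
  have [n1 H] := expr_unbounded 4 iq1; exists n1 => n /H.
  have q0' : 0 < q by rewrite lt_def q0 andbT; apply: contraTneq iq1 => ->; rewrite invr0 ltr10.
  rewrite exprVn => h; rewrite div1r -[q ^+ n]invrK lef_pV2 ?posrE // invr_gt0 exprn_gt0 //.
have BB1 : 1 < B' / B by rewrite ltr_pdivlMr // mul1r.
have [n2 Hn2] := expr_unbounded 2 BB1.
exists M, (M ^ 2)%N, (maxn n1 n2); split => // n; rewrite geq_max => /andP[/Hn1 h1 /Hn2 h2].
have := @chernoff_count _ (fun i : 'I_(2 * M ^ 2).+1 => (((i%:R - (M ^ 2)%:R) / M%:R : R) ^+ 2))
  n l eta t t' q l0 eta0 q0 u1 u2.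
apply: le_trans.
have h3 : (M%:R * B') ^+ n <= (expR (l * t') * gauss_sum l M) ^+ n.
  have w1 : 0 <= M%:R * B' by apply: mulr_ge0; exact: ltW.
  have w2 : M%:R * B' <= expR (l * t') * gauss_sum l M by rewrite mulrC.
  by rewrite lerXn2r ?nnegrE // (le_trans w1).
apply: (@le_trans _ _ ((1 - 2 * q ^+ n) * (M%:R * B') ^+ n)); last first.
  by rewrite ler_wpM2l //; lra.
have -> : (M%:R * B') ^+ n = (M%:R * B) ^+ n * (B' / B) ^+ n.
  by rewrite -exprMn; congr (_ ^+ _); field; rewrite gt_eqF.
have w3 : 0 <= (M%:R * B) ^+ n by rewrite exprn_ge0 // mulr_ge0 // ltW.
rewrite mulrCA ler_peMr //.
have : 1 / 2 * 2 <= (1 - 2 * q ^+ n) * (B' / B) ^+ n by apply: ler_pM => //; lra.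
by lra.
Unshelve. all: end_near. Qed.

End LatticeCount.

(** * The lower bound *)

Section Asymptotics.
Variable R : realType.

Lemma chi_lower_bound (m k : nat) (B0 : R) : (0 < k)%N -> 0 < B0 ->
  B0 < Gamma_chi R * Num.sqrt (m.+1%:R / k%:R) ->
  exists n0 : nat, forall n, (n0 <= n)%N -> forall c : nat,
    clique_free_colorable (@distance_graph R n (sqrt_distances R m)) k c ->
    B0 ^+ n <= c%:R.
Proof.
move=> k0 B00; rewrite /Gamma_chi; have [x [x0 _ ->]] := gamma_ratio_max R.
have [G GE] : exists G, G = Num.sqrt (pi / 2) * gamma_ratio x * Num.sqrt (m.+1%:R / k%:R :> R) by eexists.
rewrite -GE => BG.
have k0' : 0 < k%:R :> R by rewrite ltr0n.
have m0' : 0 < m.+1%:R :> R by rewrite ltr0n.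
have [u uE] : exists u, u = 1 - expR (- x) by eexists.
have u0 : 0 < u by rewrite uE subr_gt0 -expR0 ltr_expR oppr_lt0.
(* n t is p(m+1)/2 at p = n/(2kx); a prime strictly above n/(2kx) makes the squared diameter 4 n t
   strictly less than 2p(m+1). *)
have [t tE] : exists t, t = m.+1%:R / (4 * x * k%:R) :> R by eexists.
have t0 : 0 < t by rewrite tE divr_gt0 // !mulr_gt0.
have pi0 := pi_gt0 R.
have G2 : G ^+ 2 = 2 * pi * t * u ^+ 2.
  rewrite GE /gamma_ratio -uE !exprMn exprVn !sqr_sqrtr ?divr_ge0 ?(ltW pi0) ?(ltW x0) ?ler0n //.
  by rewrite tE; field; rewrite !gt_eqF.
have [B1 [B01 B1G]] : exists B1, B0 < B1 /\ B1 < G by exists ((B0 + G) / 2); split; lra.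
have B10 : 0 < B1 by lra.
have G0 : 0 < G by lra.
have GB : 1 < G / B1 by rewrite ltr_pdivlMr // mul1r.
(* A prime up to r n/(2kx) costs e^(r/2) in the base instead of e^(1/2). This r gives B1^2 e^r = B1
   G e < G^2 e, so the loss fits between B1 and G. *)
have [r rE] : exists r, r = 1 + ln (G / B1) by eexists.
have lnGB : 0 < ln (G / B1) by rewrite ln_gt0.
have r1 : 1 < r by lra.
have [B BE] : exists B, B = B1 * expR (r / 2) / u by eexists.
have Bpos : 0 < B by rewrite BE divr_gt0 // mulr_gt0 // expR_gt0.
have Bt : B ^+ 2 < 2 * pi * expR 1 * t.
  have eB : B ^+ 2 = B1 ^+ 2 * expR r / u ^+ 2.
    by rewrite BE !exprMn exprVn -expRM_natl mulrC [2%:R * _]mulrC divfK // mulrC.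
  rewrite eB ltr_pdivrMr ?exprn_gt0 //.
  have -> : 2 * pi * expR 1 * t * u ^+ 2 = G ^+ 2 * expR 1 by rewrite G2; ring.
  have -> : expR r = expR 1 * (G / B1) by rewrite rE expRD lnK // posrE; lra.
  have -> : B1 ^+ 2 * (expR 1 * (G / B1)) = B1 * G * expR 1 by field; rewrite gt_eqF.
  by rewrite ltr_pM2r ?expR_gt0 // expr2 ltr_pM2r.
have [M [K [n1 [M0 Hcount]]]] := lattice_count t0 Bpos Bt.
have [y0 Hprime] := prime_short_intervals r1.
have [e eE] : exists e, e = (2 * x * k%:R)^-1 by eexists.
have e0 : 0 < e by rewrite eE invr_gt0 !mulr_gt0.
have BB : 1 < B1 / B0 by rewrite ltr_pdivlMr // mul1r.
have A0 : 0 <= 2 * r * e * k%:R by rewrite !mulr_ge0 // ltW //; lra.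
(* The gap between B0 and B1 absorbs the factor 2 p k, which is linear in n. *)
have [n2 Hn2] := expr_linear_le A0 BB.
exists (maxn (maxn n1 n2) (Num.bound (y0 / e))) => n.
rewrite !geq_max => /andP[/andP[/Hcount cnt /Hn2 lin] nb] c col.
have yn : y0 <= e * n%:R.
  rewrite mulrC -ler_pdivrMr //; apply/ltW/(le_lt_trans (ler_norm _)).
  apply: (lt_le_trans (archi_boundP (normr_ge0 _))); rewrite ler_nat.
  by apply: leq_trans nb; rewrite /Num.bound normr_id.
have [p [pp p1 p2]] := Hprime _ yn.
have rho : 4 * (n%:R * t) < (2 * p * m.+1)%:R.
  have -> : 4 * (n%:R * t) = 2 * (e * n%:R) * m.+1%:R.
    by rewrite tE eE; field; rewrite !gt_eqF.
  by rewrite !natrM ltr_pM2r // ltr_pM2l.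
have := lattice_coloring_bound K pp M0 rho col.
rewrite -(ler_nat R) => /(le_trans cnt).
set d := (k * p.-1)%N; rewrite !natrM natrX => h.
have z0 : 0 <= expR (- x) := expR_ge0 _.
have z1 : expR (- x) <= 1 by rewrite -expR0 ler_expR oppr_le0 ltW.
have bin := bin_expr_le d n z0 z1.
rewrite -uE in bin.
have ed : expR (- (r * n%:R / 2)) <= expR (- x) ^+ d.
  rewrite -expRM_natl ler_expR mulrN lerN2.
  apply: (@le_trans _ _ (k%:R * (r * (e * n%:R)) * x)).
    rewrite ler_pM2r // /d natrM ler_pM2l //; apply: le_trans p2.
    by rewrite ler_nat leq_pred.
  by rewrite le_eqVlt; apply/orP; left; apply/eqP; rewrite eE; field; rewrite !gt_eqF.
have M0' : 0 < M%:R :> R by rewrite ltr0n.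
have un0 : 0 < u ^+ n by rewrite exprn_gt0.
have Bn : B ^+ n * (u ^+ n * expR (- (r * n%:R / 2))) = B1 ^+ n.
  have -> : expR (- (r * n%:R / 2)) = expR (- (r / 2)) ^+ n.
    by rewrite -expRM_natl; congr expR; field.
  rewrite -!exprMn; congr (_ ^+ _); rewrite BE.
  have -> : B1 * expR (r / 2) / u * (u * expR (- (r / 2))) = B1 * (expR (r / 2) * expR (- (r / 2))).
    by field; rewrite gt_eqF.
  by rewrite expRxMexpNx_1 mulr1.
have h1 : B ^+ n <= 2 * p%:R * (c%:R * (k%:R * 'C(d + n, d)%:R)).
  rewrite -(ler_pM2l (_ : 0 < M%:R ^+ n)) ?exprn_gt0 // -exprMn.
  by apply: le_trans h _; rewrite !mulrA.
have h2 : B1 ^+ n <= 2 * p%:R * (c%:R * k%:R).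
  rewrite -Bn; apply: (@le_trans _ _ (B ^+ n * (u ^+ n * expR (- x) ^+ d))).
    by rewrite ler_wpM2l ?exprn_ge0 ?(ltW Bpos) // ler_pM2l.
  have w0 : 0 <= u ^+ n * expR (- x) ^+ d by rewrite mulr_ge0 ?exprn_ge0 // ltW.
  apply: le_trans (ler_wpM2r w0 h1) _.
  have -> : 2 * p%:R * (c%:R * (k%:R * 'C(d + n, d)%:R)) * (u ^+ n * expR (- x) ^+ d) =
    2 * p%:R * (c%:R * k%:R) * ('C(d + n, d)%:R * (expR (- x) ^+ d * u ^+ n)) by ring.
  by rewrite ler_piMr // !mulr_ge0.
have h3 : 2 * p%:R * (c%:R * k%:R) <= (2 * r * e * k%:R) * n%:R * c%:R.
  have -> : (2 * r * e * k%:R) * n%:R * c%:R = 2 * (r * (e * n%:R)) * (c%:R * k%:R) by ring.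
  by rewrite ler_wpM2r ?mulr_ge0 // ler_pM2l.
have q0 : 0 < (B1 / B0) ^+ n by rewrite exprn_gt0 // divr_gt0.
have h4 : B1 ^+ n = (B1 / B0) ^+ n * B0 ^+ n.
  by rewrite -exprMn divfK // gt_eqF.
rewrite -(ler_pM2l q0) -h4; apply: (le_trans h2); apply: (le_trans h3).
by rewrite ler_wpM2r.
Qed.

End Asymptotics.

Lemma Gamma_chi_gt0 (R : realType) : 0 < Gamma_chi R.
Proof.
rewrite /Gamma_chi; have [x [x0 _ ->]] := gamma_ratio_max R.
rewrite mulr_gt0 /gamma_ratio ?sqrtr_gt0 ?divr_gt0 ?pi_gt0 ?sqrtr_gt0 //.
by rewrite subr_gt0 -expR0 ltr_expR oppr_lt0.
Qed.

Theorem theorem1p2 (R : realType) (m k : nat) (m_ge1 : (1 <= m)%N)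
    (k_ge1 : (1 <= k)%N) :
  exists eps : nat -> R,
    (eps @ \oo --> (0 : R)) /\
    forall n : nat,
      (((Gamma_chi R * Num.sqrt (m.+1%:R / k%:R) + eps n) ^+ n)%:E
        <= chi_dist k n (sqrt_distances R m))%E.
Proof.
have [G GE] : exists G, G = Gamma_chi R * Num.sqrt (m.+1%:R / k%:R) by eexists.
have G0 : 0 < G by rewrite GE mulr_gt0 ?Gamma_chi_gt0 // sqrtr_gt0 divr_gt0 ?ltr0n.
rewrite -GE.
(* A diagonal choice of the error: in dimension n take the largest j <= n for which the base G -
   G/(j+1) is already valid. The cap by n makes a maximum exist, and [chi_lower_bound] drives it to
   infinity. *)
pose P n (j : nat) := (j <= n)%N /\ forall c : nat,
  clique_free_colorable (@distance_graph R n (sqrt_distances R m)) k c ->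
  (G - G / j.+1%:R) ^+ n <= c%:R.
have P0 n : exists j, `[< P n j >].
  exists 0%N; apply/asboolP; split => // c [f _].
  (* For j = 0 the base is 0. In dimension 0 its power is 1, and one color is needed because the
     space has a point. *)
  rewrite divr1 subrr expr0n; case: n f => [|n] f //=.
  by rewrite ler1n; case: c f => // f; case: (f 0).
have Pub n j : `[< P n j >] -> (j <= n)%N by move=> /asboolP[].
pose j n := ex_maxn (P0 n) (Pub n).
have jP n : P n (j n) by rewrite /j; case: ex_maxnP => i /asboolP.
have jmax n i : P n i -> (i <= j n)%N.
  by rewrite /j; case: ex_maxnP => l _ H /asboolP; exact: H.
exists (fun n => - (G / (j n).+1%:R)); split; last first.
  move=> n; apply: le_ereal_inf_tmp => _ [c colc <-]; rewrite lee_fin.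
  by have [_] := jP n; apply.
rewrite -oppr0; apply: cvgN; apply/cvgrPdist_le => d d0.
have [i iE] : exists i : nat, i = (Num.bound (G / d)).+1 by eexists.
have Bi : 0 < G - G / i.+1%:R.
  rewrite subr_gt0 ltr_pdivrMr ?ltr0n // ltr_pMr // ltr1n iE //.
have BiG : G - G / i.+1%:R < Gamma_chi R * Num.sqrt (m.+1%:R / k%:R).
  by rewrite -GE ltrBlDr ltrDl divr_gt0 // ltr0n.
have [n0 Hn0] := chi_lower_bound k_ge1 Bi BiG.
near=> n.
have nn0 : (n0 <= n)%N by near: n; exact: nbhs_infty_ge.
have ni : (i <= n)%N by near: n; exact: nbhs_infty_ge.
have ij : (i <= j n)%N by apply: jmax; split => // c; exact: Hn0.
rewrite sub0r normrN ger0_norm ?divr_ge0 ?(ltW G0) //.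
rewrite ler_pdivrMr ?ltr0n // mulrC -ler_pdivrMr //.
apply/ltW/(le_lt_trans (ler_norm _))/(lt_le_trans (archi_boundP (normr_ge0 _))).
rewrite ler_nat /Num.bound normr_id -/(Num.bound (G / d)).
by apply: leq_trans (leqW ij); rewrite iE.
Unshelve. all: end_near. Qed.
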